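(* Let $G$ be a group object with negatives in a Cartesian tangent category $(\mathbb X,\mathbb T)$ whose Lie functor is representable. Then the Lie functor of $G$ is tangently representable if and only if it is differentiably representable.
   Context: Conventions. Composition is diagrammatic: $fg$ means first $f$, then $g$; $\langle f,g\rangle$ is pairing, $\pi_i$ are projections, $*$ is the terminal object and $!$ denotes maps to $*$. Tangent categories. A tangent structure $\mathbb T=(T,p,z,s,l,c)$ on a category $\mathbb X$ consists of an endofunctor $T$ and natural transformations $p_M:TM\to M$, $z_M:M\to TM$, $s_M:T_2M\to TM$, $l_M:TM\to TTM$, $c_M:TTM\to TTM$, where the $n$-fold pullback $T_nM$ of $p_M$ along itself exists and is preserved by all $T^k$, such that: $(p_M,z_M,s_M)$ is an additive bundle (a commutative monoid in $\mathbb X/M$); $(z_M,l_M):(p_M,z_M,s_M)\to(Tp_M,Tz_M,Ts_M)$ and $(\mathrm{id}_{TM},c_M):(p_{TM},z_{TM},s_{TM})\to(Tp_M,Tz_M,Ts_M)$ are additive bundle morphisms; $l_M\,Tl_M=l_M\,l_{TM}$, $c_Mc_M=\mathrm{id}$, $Tc_M\,c_{TM}\,Tc_M=c_{TM}\,Tc_M\,c_{TM}$, $l_Mc_M=l_M$, $l_{TM}\,Tc_M\,c_{TM}=c_M\,Tl_M$; and, with $\xi_M:=(z_{TM}\times l_M)\,Ts_M:T_2M\to TTM$, the square $\xi_M\,Tp_M=\pi_1p_Mz_M$ exhibits $T_2M$ as the pullback of $Tp_M$ along $z_M$. It is Cartesian if $\mathbb X$ has finite products and $T$ preserves them (we identify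 $T(A\times B)=TA\times TB$). An object $M$ admits negatives if there is $n_M:TM\to TM$ with $n_Mp_M=p_M$ and $\langle\mathrm{id},n_M\rangle s_M=p_Mz_M$. Lie functor. Let $G$ be a group object with unit $\mathsf e:*\to G$ and multiplication $\mathsf m_G$; each $T^nG$ is a group object with unit $T^n\mathsf e$ and multiplication $T^n\mathsf m_G$. An $A$-PLIVF on $G$ is a map $X:G\times A\to TG$ with $Xp_G=\pi_1$ and $(\mathsf m_G\times\mathrm{id}_A)X=(z_G\times X)\,T\mathsf m_G$. $\mathfrak g(A)$ is the set of $A$-PLIVFs, and $\mathfrak g(f)(X)=(\mathrm{id}_G\times f)X$ for $f:A\to B$; the contravariant functor $\mathfrak g(-)$ is the Lie functor of $G$. Let $(T^n\mathfrak g)(-)$ be the Lie functor of $T^nG$, and let $\tau_A^{T^nG}:(T^n\mathfrak g)(A)\to(T^{n+1}\mathfrak g)(TA)$ send $X$ to $TX\,c_{T^nG}$. The Lie functor is tangently representable if there is an object $\mathfrak g$ and, for every $n\ge0$, an isomorphism $\varphi_A^{T^nG}:(T^n\mathfrak g)(A)\to\mathbb X(A,T^n\mathfrak g)$ natural in $A$, such that $\varphi_{TA}^{T^{n+1}G}(\tau_A^{T^nG}(X))=T(\varphi_A^{T^nG}(X))$ for all $n,A,X$. Differential objects. A differential object is a commutative monoid $(A,0_A,+_A)$ in $\mathbb X$ with $\hat p_A:TA\to A$ such that $z_A\hat p_A={!}0_A$, $s_A\hat p_A=(\hat p_A\times\hat p_A)+_A$, $T0_A\,\hat p_A=0_A$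 (identifying $T*=*$), $T{+_A}\,\hat p_A=(\hat p_A\times\hat p_A)+_A$, $l_A\,T\hat p_A\,\hat p_A=\hat p_A$, and $\langle p_A,\hat p_A\rangle:TA\to A\times A$ is invertible. Its vertical lift $\lambda_A:A\to TA$ is the unique map with $\lambda_Ap_A={!}0_A$, $\lambda_A\hat p_A=\mathrm{id}_A$. For differential objects $A_1,\dots,A_n$ let $\lambda_k=z_{A_1}\times\dots\times\lambda_{A_k}\times\dots\times z_{A_n}$. A map $f:A_1\times\dots\times A_n\to B$ to a differential object is multilinear if $\lambda_k\,Tf=f\lambda_B$ for each $k$. An $(A_1\times\dots\times A_n)$-PLIVF $X$ is multilinear if $(z_G\times\lambda_k)\,TX=X\,l_G$ for each $k$. The Lie functor is differentiably representable if it is representable via some $\varphi_A:\mathfrak g(A)\cong\mathbb X(A,\mathfrak g)$, the representing object $\mathfrak g$ is a differential object, and, for all lists of differential objects $A_1,\dots,A_n$, $\varphi_{A_1\times\dots\times A_n}$ sends multilinear PLIVFs to multilinear maps and $\varphi^{-1}_{A_1\times\dots\times A_n}$ sends multilinear maps to multilinear PLIVFs. *)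

(* Defs.v *)
(* Built on the standard library only.  Hom-sets are types with Leibniz
   equality; composition [f ;; g] is diagrammatic (first f, then g). *)
From Stdlib Require Import List Fin.

Set Implicit Arguments.
Unset Strict Implicit.
Unset Printing Implicit Defensive.

Declare Scope cat_scope.
Delimit Scope cat_scope with cat.
Open Scope cat_scope.

Reserved Notation "A ~> B" (at level 90, no associativity).
Reserved Notation "f ;; g" (at level 40, left associativity).

Record category := Category {
  ob :> Type;
  hom : ob -> ob -> Type;
  idm : forall A, hom A A;
  comp : forall A B C, hom A B -> hom B C -> hom A C;
  comp_idl : forall A B (f : hom A B), comp (idm A) f = f;
  comp_idr : forall A B (f : hom A B), comp f (idm B) = f;
  comp_assoc : forall A B C D (f : hom A B) (g : hom B C) (h : hom C D),
    comp f (comp g h) = comp (comp f g) h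
}.

Notation "A ~> B" := (hom A B) : cat_scope.
Notation "f ;; g" := (comp f g) : cat_scope.

Arguments hom {c} A B.
Arguments idm {c} A.
Arguments comp {c A B C} f g.

Record endofunctor (X : category) := Endofunctor {
  fob :> X -> X;
  fmap : forall A B : X, (A ~> B) -> (fob A ~> fob B);
  fmap_id : forall A, fmap (idm A) = idm (fob A);
  fmap_comp : forall (A B C : X) (f : A ~> B) (g : B ~> C),
    fmap (f ;; g) = fmap f ;; fmap g
}.

Arguments fmap {X} e {A B} f.

Fixpoint fob_iter (X : category) (F : endofunctor X) (n : nat) (A : X) : X :=
  match n with
  | O => A
  | S n' => F (fob_iter F n' A)
  end.

Fixpoint fmap_iter (X : category) (F : endofunctor X) (n : nat) (A B : X)
    (f : A ~> B) : fob_iter F n A ~> fob_iter F n B :=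
  match n with
  | O => f
  | S n' => fmap F (fmap_iter F n' f)
  end.

Record pullback (X : category) (A B C : X) (f : A ~> C) (g : B ~> C)
    (P : X) (p1 : P ~> A) (p2 : P ~> B) := Pullback {
  pb_comm : p1 ;; f = p2 ;; g;
  pb_med : forall (D : X) (a : D ~> A) (b : D ~> B), a ;; f = b ;; g -> D ~> P;
  pb_med1 : forall D (a : D ~> A) (b : D ~> B) H, @pb_med D a b H ;; p1 = a;
  pb_med2 : forall D (a : D ~> A) (b : D ~> B) H, @pb_med D a b H ;; p2 = b;
  pb_uniq : forall (D : X) (u v : D ~> P),
    u ;; p1 = v ;; p1 -> u ;; p2 = v ;; p2 -> u = v
}.

(* The I-fold pullback of q : E -> M along itself.  The map b : P -> M to the
   base is part of the cone, so that the 0-fold pullback is M. *)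
Record wide_pullback (X : category) (I : Type) (E M : X) (q : E ~> M)
    (P : X) (pr : I -> P ~> E) (b : P ~> M) := WidePullback {
  wp_comm : forall i, pr i ;; q = b;
  wp_med : forall (D : X) (f : I -> D ~> E) (g : D ~> M),
    (forall i, f i ;; q = g) -> D ~> P;
  wp_med_pr : forall D (f : I -> D ~> E) (g : D ~> M) H i,
    @wp_med D f g H ;; pr i = f i;
  wp_med_base : forall D (f : I -> D ~> E) (g : D ~> M) H,
    @wp_med D f g H ;; b = g;
  wp_uniq : forall (D : X) (u v : D ~> P),
    (forall i, u ;; pr i = v ;; pr i) -> u ;; b = v ;; b -> u = v
}.

Definition two (T : Type) (x y : T) (i : Fin.t 2) : T :=
  match i with
  | Fin.F1 => x
  | Fin.FS _ => y
  end.

(* A bundle q : E -> M with its fibre powers E_n, and maps in X/M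
   playing the roles of a constant and of a binary operation. *)
Record bundle (X : category) := Bundle {
  bd_base : X;
  bd_tot : X;
  bd_q : bd_tot ~> bd_base;
  bd_pow : nat -> X;
  bd_pr : forall n, Fin.t n -> bd_pow n ~> bd_tot;
  bd_pow_q : forall n, bd_pow n ~> bd_base;
  bd_pb : forall n, wide_pullback bd_q (@bd_pr n) (bd_pow_q n);
  bd_zero : bd_base ~> bd_tot;
  bd_add : bd_pow 2 ~> bd_tot;
  bd_zero_q : bd_zero ;; bd_q = idm bd_base;
  bd_add_q : bd_add ;; bd_q = bd_pow_q 2
}.

Arguments bd_pr {X} b n i.
Arguments bd_pow_q {X} b n.
Arguments bd_pb {X} b n.

Section BundleTheory.
Variables (X : category) (B : bundle X).
Implicit Type D : X.

Lemma two_over D (f g : D ~> bd_tot B) (H : f ;; bd_q B = g ;; bd_q B) :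
  forall i, two f g i ;; bd_q B = f ;; bd_q B.
Proof.
intro i; apply (Fin.caseS' i); [reflexivity | intro j; exact (eq_sym H)].
Qed.

Definition bpair D (f g : D ~> bd_tot B) (H : f ;; bd_q B = g ;; bd_q B) :
  D ~> bd_pow B 2 := wp_med (bd_pb B 2) (two_over H).

(* Fibrewise sum of two generalized elements of the same fibre. *)
Definition bplus D (f g : D ~> bd_tot B) (H : f ;; bd_q B = g ;; bd_q B) :
  D ~> bd_tot B := bpair H ;; bd_add B.

Lemma bplus_q D (f g : D ~> bd_tot B) (H : f ;; bd_q B = g ;; bd_q B) :
  bplus H ;; bd_q B = f ;; bd_q B.
Proof.
unfold bplus; rewrite <- comp_assoc, bd_add_q.
exact (wp_med_base (bd_pb B 2) (two_over H)).
Qed.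

Lemma bpr_eq n (i j : Fin.t n) :
  bd_pr B n i ;; bd_q B = bd_pr B n j ;; bd_q B.
Proof. now rewrite !(wp_comm (bd_pb B n)). Qed.

Lemma bzero_fibre :
  (bd_q B ;; bd_zero B) ;; bd_q B = idm (bd_tot B) ;; bd_q B.
Proof. now rewrite <- comp_assoc, bd_zero_q, comp_idr, comp_idl. Qed.

Lemma bplus_fibre_l D (f g h : D ~> bd_tot B)
  (Hfg : f ;; bd_q B = g ;; bd_q B) (Hfh : f ;; bd_q B = h ;; bd_q B) :
  bplus Hfg ;; bd_q B = h ;; bd_q B.
Proof. now rewrite bplus_q. Qed.

Lemma bplus_fibre_r D (f g h : D ~> bd_tot B)
  (Hgh : g ;; bd_q B = h ;; bd_q B) (Hfg : f ;; bd_q B = g ;; bd_q B) :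
  f ;; bd_q B = bplus Hgh ;; bd_q B.
Proof. now rewrite bplus_q. Qed.

(* (E -> M, zero, add) is a commutative monoid in X/M. *)
Record additive_bundle : Prop := AdditiveBundle {
  ab_assoc :
    let x : Fin.t 3 := Fin.F1 in
    let y : Fin.t 3 := Fin.FS Fin.F1 in
    let w : Fin.t 3 := Fin.FS (Fin.FS Fin.F1) in
    bplus (bplus_fibre_l (bpr_eq x y) (bpr_eq x w)) =
    bplus (bplus_fibre_r (bpr_eq y w) (bpr_eq x y));
  ab_comm :
    let x : Fin.t 2 := Fin.F1 in
    let y : Fin.t 2 := Fin.FS Fin.F1 in
    bplus (bpr_eq x y) = bplus (bpr_eq y x);
  ab_unit : bplus bzero_fibre = idm (bd_tot B)
}.

End BundleTheory.

Lemma bmor_fibre (X : category) (B B' : bundle X)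
  (f : bd_base B ~> bd_base B') (g : bd_tot B ~> bd_tot B')
  (H : g ;; bd_q B' = bd_q B ;; f) (i j : Fin.t 2) :
  (bd_pr B 2 i ;; g) ;; bd_q B' = (bd_pr B 2 j ;; g) ;; bd_q B'.
Proof.
rewrite <- !comp_assoc, !H, !comp_assoc. now rewrite (bpr_eq B i j).
Qed.

Record additive_morphism (X : category) (B B' : bundle X)
    (f : bd_base B ~> bd_base B') (g : bd_tot B ~> bd_tot B') : Prop :=
  AdditiveMorphism {
  am_q : g ;; bd_q B' = bd_q B ;; f;
  am_zero : bd_zero B ;; g = f ;; bd_zero B';
  am_add : bd_add B ;; g = bplus (bmor_fibre am_q Fin.F1 (Fin.FS Fin.F1))
}.

Record tangent_bundle (X : category) := TangentBundle {
  tanT :> endofunctor X;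
  tanp : forall M : X, tanT M ~> M;
  tanp_nat : forall (M N : X) (f : M ~> N),
    tanp M ;; f = fmap tanT f ;; tanp N;
  tanpow : nat -> X -> X;
  tanpr : forall n (M : X), Fin.t n -> tanpow n M ~> tanT M;
  tanpow_p : forall n (M : X), tanpow n M ~> M;
  (* The case k = 0 is the existence of the pullback. *)
  tanpow_pb : forall k n (M : X),
    wide_pullback (fmap_iter tanT k (tanp M))
      (fun i => fmap_iter tanT k (tanpr M i)) (fmap_iter tanT k (tanpow_p n M))
}.

Arguments tanp {X} t M.
Arguments tanpow {X} t n M.
Arguments tanpr {X} t n M i.
Arguments tanpow_p {X} t n M.

Section TangentPow.
Variables (X : category) (T : tangent_bundle X).

Definition tpi1 (M : X) : tanpow T 2 M ~> T M := tanpr T 2 M Fin.F1.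
Definition tpi2 (M : X) : tanpow T 2 M ~> T M := tanpr T 2 M (Fin.FS Fin.F1).

Lemma tanpow_map_over n (M N : X) (f : M ~> N) (i : Fin.t n) :
  (tanpr T n M i ;; fmap T f) ;; tanp T N = tanpow_p T n M ;; f.
Proof.
rewrite <- comp_assoc, <- tanp_nat, comp_assoc.
now rewrite (wp_comm (tanpow_pb T 0 n M) i : tanpr T n M i ;; tanp T M = _).
Qed.

Definition tanpow_map n (M N : X) (f : M ~> N) : tanpow T n M ~> tanpow T n N :=
  wp_med (tanpow_pb T 0 n N) (@tanpow_map_over n M N f).

End TangentPow.

Record tangent_data (X : category) := TangentData {
  td_T :> tangent_bundle X;
  tanz : forall M : X, M ~> td_T M;
  tans : forall M : X, tanpow td_T 2 M ~> td_T M;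
  tanl : forall M : X, td_T M ~> td_T (td_T M);
  tanc : forall M : X, td_T (td_T M) ~> td_T (td_T M);
  tanz_nat : forall (M N : X) (f : M ~> N),
    tanz M ;; fmap td_T f = f ;; tanz N;
  tans_nat : forall (M N : X) (f : M ~> N),
    tans M ;; fmap td_T f = tanpow_map td_T 2 f ;; tans N;
  tanl_nat : forall (M N : X) (f : M ~> N),
    tanl M ;; fmap td_T (fmap td_T f) = fmap td_T f ;; tanl N;
  tanc_nat : forall (M N : X) (f : M ~> N),
    tanc M ;; fmap td_T (fmap td_T f) = fmap td_T (fmap td_T f) ;; tanc N;
  tanz_p : forall M : X, tanz M ;; tanp td_T M = idm M;
  tans_p : forall M : X, tans M ;; tanp td_T M = tanpow_p td_T 2 M
}.

Arguments tanz {X} t M.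
Arguments tans {X} t M.
Arguments tanl {X} t M.
Arguments tanc {X} t M.

Section TangentBundles.
Variables (X : category) (T : tangent_data X).

Definition p_bundle (M : X) : bundle X := {|
  bd_base := M;
  bd_tot := T M;
  bd_q := tanp T M;
  bd_pow := fun n => tanpow T n M;
  bd_pr := fun n => tanpr T n M;
  bd_pow_q := fun n => tanpow_p T n M;
  bd_pb := fun n => tanpow_pb T 0 n M;
  bd_zero := tanz T M;
  bd_add := tans T M;
  bd_zero_q := tanz_p T M;
  bd_add_q := tans_p T M
|}.

Lemma Tp_zero_q (M : X) :
  fmap T (tanz T M) ;; fmap T (tanp T M) = idm (T M).
Proof. now rewrite <- fmap_comp, tanz_p, fmap_id. Qed.

Lemma Tp_add_q (M : X) :
  fmap T (tans T M) ;; fmap T (tanp T M) = fmap T (tanpow_p T 2 M).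
Proof. now rewrite <- fmap_comp, tans_p. Qed.

Definition Tp_bundle (M : X) : bundle X := {|
  bd_base := T M;
  bd_tot := T (T M);
  bd_q := fmap T (tanp T M);
  bd_pow := fun n => T (tanpow T n M);
  bd_pr := fun n i => fmap T (tanpr T n M i);
  bd_pow_q := fun n => fmap T (tanpow_p T n M);
  bd_pb := fun n => tanpow_pb T 1 n M;
  bd_zero := fmap T (tanz T M);
  bd_add := fmap T (tans T M);
  bd_zero_q := Tp_zero_q M;
  bd_add_q := Tp_add_q M
|}.

Lemma xi_fibre (M : X)
  (H : tanl T M ;; fmap T (tanp T M) = tanp T M ;; tanz T M) :
  (tpi1 T M ;; tanz T (T M)) ;; fmap T (tanp T M) =
  (tpi2 T M ;; tanl T M) ;; fmap T (tanp T M).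
Proof.
rewrite <- !comp_assoc, H, tanz_nat, !comp_assoc.
now rewrite (bpr_eq (p_bundle M) Fin.F1 (Fin.FS Fin.F1)
             : tpi1 T M ;; tanp T M = tpi2 T M ;; tanp T M).
Qed.

(* xi_M = (z_TM x l_M) ; T s_M, where (z_TM x l_M) : T_2 M -> T(T_2 M) is the
   map into the preserved pullback T(T_2 M). *)
Definition xi (M : X)
  (H : tanl T M ;; fmap T (tanp T M) = tanp T M ;; tanz T M) :
  tanpow T 2 M ~> T (T M) :=
  bplus (B := Tp_bundle M) (xi_fibre H).

End TangentBundles.

Record tangent_structure (X : category) := TangentStructure {
  ts_data :> tangent_data X;
  ts_add : forall M : X, additive_bundle (p_bundle ts_data M);
  ts_l_add : forall M : X,
    additive_morphism (B := p_bundle ts_data M) (B' := Tp_bundle ts_data M)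
      (tanz ts_data M) (tanl ts_data M);
  ts_c_add : forall M : X,
    additive_morphism (B := p_bundle ts_data (ts_data M))
      (B' := Tp_bundle ts_data M) (idm (ts_data M)) (tanc ts_data M);
  ts_ll : forall M : X,
    tanl ts_data M ;; fmap ts_data (tanl ts_data M) =
    tanl ts_data M ;; tanl ts_data (ts_data M);
  ts_cc : forall M : X,
    tanc ts_data M ;; tanc ts_data M = idm (ts_data (ts_data M));
  ts_ccc : forall M : X,
    fmap ts_data (tanc ts_data M) ;; tanc ts_data (ts_data M)
      ;; fmap ts_data (tanc ts_data M) =
    tanc ts_data (ts_data M) ;; fmap ts_data (tanc ts_data M)
      ;; tanc ts_data (ts_data M);
  ts_lc : forall M : X, tanl ts_data M ;; tanc ts_data M = tanl ts_data M;
  ts_lcc : forall M : X,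
    tanl ts_data (ts_data M) ;; fmap ts_data (tanc ts_data M)
      ;; tanc ts_data (ts_data M) =
    tanc ts_data M ;; fmap ts_data (tanl ts_data M);
  ts_univ : forall M : X,
    pullback (fmap ts_data (tanp ts_data M)) (tanz ts_data M)
      (xi (am_q (ts_l_add M))) (tpi1 ts_data M ;; tanp ts_data M)
}.

Record finite_products (X : category) := FiniteProducts {
  fp_one : X;
  fp_bang : forall A : X, A ~> fp_one;
  fp_bang_uniq : forall (A : X) (f g : A ~> fp_one), f = g;
  fp_prod : X -> X -> X;
  fp_pi1 : forall A B : X, fp_prod A B ~> A;
  fp_pi2 : forall A B : X, fp_prod A B ~> B;
  fp_pair : forall D A B : X, (D ~> A) -> (D ~> B) -> (D ~> fp_prod A B);
  fp_pair_pi1 : forall (D A B : X) (f : D ~> A) (g : D ~> B),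
    fp_pair f g ;; fp_pi1 A B = f;
  fp_pair_pi2 : forall (D A B : X) (f : D ~> A) (g : D ~> B),
    fp_pair f g ;; fp_pi2 A B = g;
  fp_pair_uniq : forall (D A B : X) (u v : D ~> fp_prod A B),
    u ;; fp_pi1 A B = v ;; fp_pi1 A B -> u ;; fp_pi2 A B = v ;; fp_pi2 A B -> u = v
}.

(* [Tone] and [Tprod] are the identifications * = T* and TA x TB = T(A x B):
   they are inverse to the canonical comparison maps. *)
Record cartesian_tangent_category := CartesianTangentCategory {
  ct_cat :> category;
  ct_T : tangent_structure ct_cat;
  ct_prod : finite_products ct_cat;
  Tone : fp_one ct_prod ~> ct_T (fp_one ct_prod);
  bangK : fp_bang ct_prod (ct_T (fp_one ct_prod)) ;; Tone = idm _;
  Tprod : forall A B : ct_cat,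
    fp_prod ct_prod (ct_T A) (ct_T B) ~> ct_T (fp_prod ct_prod A B);
  TprodK : forall A B : ct_cat,
    Tprod A B ;;
      fp_pair ct_prod (fmap ct_T (fp_pi1 ct_prod A B)) (fmap ct_T (fp_pi2 ct_prod A B))
    = idm _;
  TprodVK : forall A B : ct_cat,
    fp_pair ct_prod (fmap ct_T (fp_pi1 ct_prod A B)) (fmap ct_T (fp_pi2 ct_prod A B)) ;;
      Tprod A B
    = idm _
}.

Arguments Tone : clear implicits.
Arguments Tprod : clear implicits.

Notation T X := (ct_T X).
Notation one := (fp_one (ct_prod _)).
Notation "A ** B" := (fp_prod (ct_prod _) A B)
  (at level 38, right associativity) : cat_scope.
Notation "<| f , g |>" := (fp_pair (ct_prod _) f g)
  (at level 0, f at level 99, g at level 99) : cat_scope.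
Notation p1 := (fp_pi1 (ct_prod _) _ _).
Notation p2 := (fp_pi2 (ct_prod _) _ _).
Notation bang := (fp_bang (ct_prod _) _).

Section Cartesian.
Variable X : cartesian_tangent_category.
Implicit Types A B C D : X.

Definition prod_map A B C D (f : A ~> C) (g : B ~> D) : A ** B ~> C ** D :=
  <| p1 ;; f, p2 ;; g |>.

Definition assoc A B C : A ** (B ** C) ~> (A ** B) ** C :=
  <| <| p1, p2 ;; p1 |>, p2 ;; p2 |>.

Lemma pair_comp D' D A B (h : D' ~> D) (f : D ~> A) (g : D ~> B) :
  h ;; <| f, g |> = <| h ;; f, h ;; g |>.
Proof.
apply fp_pair_uniq; rewrite <- comp_assoc, ?fp_pair_pi1, ?fp_pair_pi2; reflexivity.
Qed.

Lemma Tprod1 A B : Tprod X A B ;; fmap (T X) p1 = p1.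
Proof.
rewrite <- (fp_pair_pi1 (ct_prod X) (fmap (T X) (fp_pi1 (ct_prod X) A B))
              (fmap (T X) (fp_pi2 (ct_prod X) A B))).
now rewrite comp_assoc, TprodK, comp_idl.
Qed.

Lemma Tprod2 A B : Tprod X A B ;; fmap (T X) p2 = p2.
Proof.
rewrite <- (fp_pair_pi2 (ct_prod X) (fmap (T X) (fp_pi1 (ct_prod X) A B))
              (fmap (T X) (fp_pi2 (ct_prod X) A B))).
now rewrite comp_assoc, TprodK, comp_idl.
Qed.

Lemma Tprod_uniq D A B (u v : D ~> T X (A ** B)) :
  u ;; fmap (T X) p1 = v ;; fmap (T X) p1 ->
  u ;; fmap (T X) p2 = v ;; fmap (T X) p2 -> u = v.
Proof.
intros H1 H2.
rewrite <- (comp_idr u), <- (comp_idr v), <- TprodVK, !comp_assoc.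
f_equal; rewrite !pair_comp; now f_equal.
Qed.

Lemma Tone_uniq D (u v : D ~> T X one) : u = v.
Proof.
rewrite <- (comp_idr u), <- (comp_idr v), <- bangK, !comp_assoc.
f_equal; apply fp_bang_uniq.
Qed.

Lemma Tprod1_comp D A B (h : D ~> T X A ** T X B) :
  h ;; Tprod X A B ;; fmap (T X) p1 = h ;; p1.
Proof. now rewrite <- comp_assoc, Tprod1. Qed.

Lemma Tprod2_comp D A B (h : D ~> T X A ** T X B) :
  h ;; Tprod X A B ;; fmap (T X) p2 = h ;; p2.
Proof. now rewrite <- comp_assoc, Tprod2. Qed.

(* Left-associated normal form, with pairings pushed outwards. *)
Local Ltac cart := repeat first
  [ rewrite pair_comp | rewrite comp_assoc | rewrite fp_pair_pi1
  | rewrite fp_pair_pi2 | rewrite comp_idl | rewrite comp_idr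
  | rewrite Tprod1_comp | rewrite Tprod2_comp | rewrite Tprod1
  | rewrite Tprod2 ].

Record group_object := GroupObject {
  gobj :> X;
  gunit : one ~> gobj;
  gmul : gobj ** gobj ~> gobj;
  ginv : gobj ~> gobj;
  gmulA : assoc gobj gobj gobj ;; prod_map gmul (idm gobj) ;; gmul =
          prod_map (idm gobj) gmul ;; gmul;
  gmul1g : <| bang ;; gunit, idm gobj |> ;; gmul = idm gobj;
  gmulg1 : <| idm gobj, bang ;; gunit |> ;; gmul = idm gobj;
  gmulVg : <| ginv, idm gobj |> ;; gmul = bang ;; gunit;
  gmulgV : <| idm gobj, ginv |> ;; gmul = bang ;; gunit
}.

Lemma Tpair_map D A B (f : D ~> A) (g : D ~> B) :
  fmap (T X) <| f, g |> = <| fmap (T X) f, fmap (T X) g |> ;; Tprod X A B.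
Proof.
apply Tprod_uniq.
- now rewrite <- fmap_comp, <- comp_assoc, Tprod1, !fp_pair_pi1.
- now rewrite <- fmap_comp, <- comp_assoc, Tprod2, !fp_pair_pi2.
Qed.

Lemma Tbang D : fmap (T X) (fp_bang (ct_prod X) D) = bang ;; Tone X.
Proof. apply Tone_uniq. Qed.

Section TangentGroup.
Variable G : group_object.

Let mT : T X G ** T X G ~> T X G := Tprod X G G ;; fmap (T X) (gmul G).
Let eT : one ~> T X G := Tone X ;; fmap (T X) (gunit G).

Lemma tangent_gmulA :
  assoc (T X G) (T X G) (T X G) ;; prod_map mT (idm (T X G)) ;; mT =
  prod_map (idm (T X G)) mT ;; mT.
Proof.
set (w := prod_map (idm (T X G)) (Tprod X G G) ;; Tprod X G (G ** G)).
assert (w1 : w ;; fmap (T X) p1 = p1).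
{ unfold w, prod_map; now cart. }
assert (w2 : w ;; fmap (T X) p2 = p2 ;; Tprod X G G).
{ unfold w, prod_map; now cart. }
transitivity (w ;; fmap (T X)
  (assoc G G G ;; prod_map (gmul G) (idm G) ;; gmul G)).
- unfold mT, assoc, prod_map; cart. rewrite fmap_comp, Tpair_map; cart.
  do 3 f_equal.
  + rewrite fmap_comp, Tpair_map, fmap_comp; cart.
    rewrite w1, w2; now cart.
  + rewrite fmap_comp, comp_assoc, w2; now cart.
- rewrite gmulA. unfold mT, prod_map; cart.
  rewrite fmap_comp, Tpair_map, fmap_comp; cart.
  now rewrite w1, w2.
Qed.

Lemma tangent_mul_pair D (f g : D ~> G) :
  <| fmap (T X) f, fmap (T X) g |> ;; mT = fmap (T X) (<| f, g |> ;; gmul G).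
Proof. unfold mT. now rewrite comp_assoc, <- Tpair_map, <- fmap_comp. Qed.

Lemma tangent_unit D :
  fmap (T X) (fp_bang (ct_prod X) D ;; gunit G) = bang ;; eT.
Proof. unfold eT. now rewrite fmap_comp, Tbang, comp_assoc. Qed.

Lemma tangent_gmul1g : <| bang ;; eT, idm (T X G) |> ;; mT = idm (T X G).
Proof.
now rewrite <- tangent_unit, <- fmap_id, tangent_mul_pair, gmul1g.
Qed.

Lemma tangent_gmulg1 : <| idm (T X G), bang ;; eT |> ;; mT = idm (T X G).
Proof.
now rewrite <- tangent_unit, <- fmap_id, tangent_mul_pair, gmulg1.
Qed.

Lemma tangent_gmulVg :
  <| fmap (T X) (ginv G), idm (T X G) |> ;; mT = bang ;; eT.
Proof.
now rewrite <- tangent_unit, <- fmap_id, tangent_mul_pair, gmulVg.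
Qed.

Lemma tangent_gmulgV :
  <| idm (T X G), fmap (T X) (ginv G) |> ;; mT = bang ;; eT.
Proof.
now rewrite <- tangent_unit, <- fmap_id, tangent_mul_pair, gmulgV.
Qed.

Definition tangent_group : group_object := {|
  gobj := T X G;
  gunit := Tone X ;; fmap (T X) (gunit G);
  gmul := Tprod X G G ;; fmap (T X) (gmul G);
  ginv := fmap (T X) (ginv G);
  gmulA := tangent_gmulA;
  gmul1g := tangent_gmul1g;
  gmulg1 := tangent_gmulg1;
  gmulVg := tangent_gmulVg;
  gmulgV := tangent_gmulgV
|}.

End TangentGroup.

Fixpoint tangent_group_iter (n : nat) (G : group_object) : group_object :=
  match n with
  | O => G
  | S n' => tangent_group (tangent_group_iter n' G)
  end.

Lemma neg_fibre (M : X) (n : T X M ~> T X M) (H : n ;; tanp (T X) M = tanp (T X) M) :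
  idm (T X M) ;; tanp (T X) M = n ;; tanp (T X) M.
Proof. now rewrite H, comp_idl. Qed.

Definition admits_negatives (M : X) : Prop :=
  exists (n : T X M ~> T X M) (H : n ;; tanp (T X) M = tanp (T X) M),
    bpair (B := p_bundle (T X) M) (neg_fibre H) ;; tans (T X) M =
    tanp (T X) M ;; tanz (T X) M.

Definition is_PLIVF (G : group_object) A (V : G ** A ~> T X G) : Prop :=
  V ;; tanp (T X) G = p1 /\
  assoc G G A ;; prod_map (gmul G) (idm A) ;; V =
  prod_map (tanz (T X) G) V ;; gmul (tangent_group G).

Definition PLIVF (G : group_object) A : Type :=
  { V : G ** A ~> T X G | is_PLIVF V }.

Lemma lie_map_proof (G : group_object) A B (f : A ~> B) (V : PLIVF G B) :
  is_PLIVF (prod_map (idm G) f ;; proj1_sig V).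
Proof.
destruct V as [V [V1 V2]]; cbn [proj1_sig]; split.
- rewrite <- comp_assoc, V1. unfold prod_map.
  now rewrite fp_pair_pi1, comp_idr.
- assert (E : assoc G G A ;; prod_map (gmul G) (idm A) ;; prod_map (idm G) f =
    prod_map (idm G) (prod_map (idm G) f) ;;
    (assoc G G B ;; prod_map (gmul G) (idm B))).
  { unfold assoc, prod_map; now cart. }
  rewrite comp_assoc, E, <- comp_assoc, V2, comp_assoc. f_equal.
  unfold prod_map. rewrite pair_comp. f_equal.
  + now rewrite comp_assoc, fp_pair_pi1, comp_idr.
  + now rewrite !comp_assoc, fp_pair_pi2.
Qed.

Definition lie_map (G : group_object) A B (f : A ~> B) (V : PLIVF G B) :
  PLIVF G A := exist _ _ (lie_map_proof f V).

Lemma TTprod_uniq D A B (u v : D ~> T X (T X (A ** B))) :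
  u ;; fmap (T X) (fmap (T X) p1) = v ;; fmap (T X) (fmap (T X) p1) ->
  u ;; fmap (T X) (fmap (T X) p2) = v ;; fmap (T X) (fmap (T X) p2) -> u = v.
Proof.
intros H1 H2.
rewrite <- (comp_idr u), <- (comp_idr v), <- (fmap_id (T X)), <- TprodVK.
rewrite fmap_comp, !comp_assoc. f_equal.
apply Tprod_uniq; rewrite <- !comp_assoc, <- !fmap_comp;
  now rewrite ?fp_pair_pi1, ?fp_pair_pi2.
Qed.

Lemma tanc_p (M : X) :
  tanc (T X) M ;; tanp (T X) (T X M) = fmap (T X) (tanp (T X) M).
Proof.
generalize (am_q (ts_c_add (T X) M)); cbn; rewrite comp_idr; intros <-.
now rewrite comp_assoc, ts_cc, comp_idl.
Qed.

Lemma tanz_c (M : X) :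
  fmap (T X) (tanz (T X) M) ;; tanc (T X) M = tanz (T X) (T X M).
Proof.
generalize (am_zero (ts_c_add (T X) M)); cbn; rewrite comp_idl; intros <-.
now rewrite <- comp_assoc, ts_cc, comp_idr.
Qed.

Lemma tau_proof (G : group_object) A (V : PLIVF G A) :
  @is_PLIVF (tangent_group G) (T X A)
    (Tprod X G A ;; fmap (T X) (proj1_sig V) ;; tanc (T X) G).
Proof.
destruct V as [V [V1 V2]]; cbn [proj1_sig]; split.
- cbn [gobj tangent_group].
  rewrite <- comp_assoc, tanc_p, <- comp_assoc, <- fmap_comp, V1.
  apply Tprod1.
- cbn [gobj gmul tangent_group] in V2 |- *.
  set (w := prod_map (idm (T X G)) (Tprod X G A) ;; Tprod X G (G ** A)).
  assert (w1 : w ;; fmap (T X) p1 = p1).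
  { unfold w, prod_map; now cart. }
  assert (w2 : w ;; fmap (T X) p2 = p2 ;; Tprod X G A).
  { unfold w, prod_map; now cart. }
  transitivity (w ;; fmap (T X)
    (assoc G G A ;; prod_map (gmul G) (idm A) ;; V) ;; tanc (T X) G).
  { rewrite fmap_comp; cart. do 2 f_equal.
    unfold assoc, prod_map; cart. rewrite Tpair_map; cart. f_equal. f_equal.
    - rewrite fmap_comp, Tpair_map, fmap_comp; cart. now rewrite w1, w2; cart.
    - rewrite fmap_comp, comp_assoc, w2; now cart. }
  rewrite V2, !fmap_comp; cart.
  rewrite <- (comp_assoc _ _ (tanc (T X) G)), <- tanc_nat, comp_assoc.
  f_equal. apply TTprod_uniq.
  + rewrite <- (comp_assoc _ (tanc _ _)), tanc_nat; cart.
    rewrite <- !(comp_assoc _ (fmap _ _) (fmap _ _)), <- !fmap_comp, !Tprod1.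
    unfold prod_map; cart.
    rewrite <- (comp_assoc w), <- fmap_comp, fp_pair_pi1, fmap_comp; cart.
    now rewrite w1, <- comp_assoc, tanz_c.
  + rewrite <- (comp_assoc _ (tanc _ _)), tanc_nat; cart.
    rewrite <- !(comp_assoc _ (fmap _ _) (fmap _ _)), <- !fmap_comp, !Tprod2.
    unfold prod_map; cart.
    rewrite <- (comp_assoc w), <- fmap_comp, fp_pair_pi2, fmap_comp; cart.
    now rewrite w2.
Qed.

Definition tau (G : group_object) A (V : PLIVF G A) :
  PLIVF (tangent_group G) (T X A) := exist _ _ (tau_proof V).

Record representation (G : group_object) (g : X) := Representation {
  rep_fun :> forall A, PLIVF G A -> (A ~> g);
  rep_inv : forall A, (A ~> g) -> PLIVF G A;
  rep_funK : forall A (V : PLIVF G A), rep_inv (rep_fun V) = V;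
  rep_invK : forall A (f : A ~> g), rep_fun (rep_inv f) = f;
  rep_nat : forall A B (f : A ~> B) (V : PLIVF G B),
    rep_fun (lie_map f V) = f ;; rep_fun V
}.

Definition lie_representable (G : group_object) : Prop :=
  exists g : X, inhabited (representation G g).

Definition tangently_representable (G : group_object) : Prop :=
  exists (g : X)
    (phi : forall n,
       representation (tangent_group_iter n G) (fob_iter (T X) n g)),
  forall n A (V : PLIVF (tangent_group_iter n G) A),
    phi (S n) (T X A) (tau V) = fmap (T X) (phi n A V).

Record differential_object := DifferentialObject {
  dobj :> X;
  dzero : one ~> dobj;
  dadd : dobj ** dobj ~> dobj;
  daddA : assoc dobj dobj dobj ;; prod_map dadd (idm dobj) ;; dadd =
          prod_map (idm dobj) dadd ;; dadd;
  daddC : <| p2, p1 |> ;; dadd = dadd;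
  dadd0 : <| bang ;; dzero, idm dobj |> ;; dadd = idm dobj;
  dhat : T X dobj ~> dobj;
  dhat_z : tanz (T X) dobj ;; dhat = bang ;; dzero;
  dhat_s : tans (T X) dobj ;; dhat =
           <| tpi1 (T X) dobj ;; dhat, tpi2 (T X) dobj ;; dhat |> ;; dadd;
  dhat_zero : Tone X ;; fmap (T X) dzero ;; dhat = dzero;
  dhat_add : Tprod X dobj dobj ;; fmap (T X) dadd ;; dhat =
             prod_map dhat dhat ;; dadd;
  dhat_l : tanl (T X) dobj ;; fmap (T X) dhat ;; dhat = dhat;
  dsplit : dobj ** dobj ~> T X dobj;
  dsplitK : dsplit ;; <| tanp (T X) dobj, dhat |> = idm _;
  dsplitVK : <| tanp (T X) dobj, dhat |> ;; dsplit = idm _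
}.

Definition vlift (A : differential_object) : A ~> T X A :=
  <| bang ;; dzero A, idm A |> ;; dsplit A.

Lemma vlift_unique (A : differential_object) :
  unique (fun v : A ~> T X A =>
    v ;; tanp (T X) A = bang ;; dzero A /\ v ;; dhat A = idm A) (vlift A).
Proof.
assert (E : vlift A ;; <| tanp (T X) A, dhat A |> = <| bang ;; dzero A, idm A |>).
{ unfold vlift. now rewrite <- comp_assoc, dsplitK, comp_idr. }
rewrite pair_comp in E. split; [split|].
- now rewrite <- (fp_pair_pi1 (ct_prod X) (vlift A ;; tanp (T X) A) (vlift A ;; dhat A)),
    E, fp_pair_pi1.
- now rewrite <- (fp_pair_pi2 (ct_prod X) (vlift A ;; tanp (T X) A) (vlift A ;; dhat A)),
    E, fp_pair_pi2.
- intros v [H1 H2]. unfold vlift. rewrite <- H1, <- H2, <- pair_comp.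
  now rewrite <- comp_assoc, dsplitVK, comp_idr.
Qed.

(* The product of the list A :: l, and on it the map whose j-th component is
   the vertical lift if [sel j], and z otherwise. *)
Fixpoint diff_prod1 (A : differential_object) (l : list differential_object) : X :=
  match l with
  | nil => A
  | cons B l' => A ** diff_prod1 B l'
  end.

Definition lift_or_zero (b : bool) (A : differential_object) : A ~> T X A :=
  if b then vlift A else tanz (T X) A.

Fixpoint diff_lift1 (sel : nat -> bool) (A : differential_object)
    (l : list differential_object) : diff_prod1 A l ~> T X (diff_prod1 A l) :=
  match l with
  | nil => lift_or_zero (sel 0) A
  | cons B l' =>
      prod_map (lift_or_zero (sel 0) A) (diff_lift1 (fun j => sel (S j)) B l')
      ;; Tprod X A (diff_prod1 B l')
  end.

Definition diff_prod (l : list differential_object) : X :=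
  match l with
  | nil => one
  | cons A l' => diff_prod1 A l'
  end.

(* z x ... x vlift x ... x z with vlift in position k (counted from 0) *)
Definition diff_lift (k : nat) (l : list differential_object) :
    diff_prod l ~> T X (diff_prod l) :=
  match l with
  | nil => tanz (T X) one
  | cons A l' => diff_lift1 (Nat.eqb k) A l'
  end.

Definition multilinear (l : list differential_object) (B : differential_object)
    (f : diff_prod l ~> B) : Prop :=
  forall k, k < length l -> diff_lift k l ;; fmap (T X) f = f ;; vlift B.

Definition multilinear_PLIVF (G : group_object) (l : list differential_object)
    (V : PLIVF G (diff_prod l)) : Prop :=
  forall k, k < length l ->
    prod_map (tanz (T X) G) (diff_lift k l) ;; Tprod X G (diff_prod l) ;;
      fmap (T X) (proj1_sig V) =
    proj1_sig V ;; tanl (T X) G.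

Arguments multilinear l {B} f.
Arguments multilinear_PLIVF {G} l V.

Definition differentiably_representable (G : group_object) : Prop :=
  exists (g : differential_object) (phi : representation G g),
  forall l : list differential_object,
    (forall V : PLIVF G (diff_prod l),
       multilinear_PLIVF l V -> multilinear l (phi (diff_prod l) V)) /\
    (forall f : diff_prod l ~> g,
       multilinear l f -> multilinear_PLIVF l (rep_inv phi f)).

End Cartesian.

Arguments multilinear {X} l {B} f.
Arguments multilinear_PLIVF {X G} l V.

(* Main.v *)
From Stdlib Require Import ssreflect ssrfun ssrbool ProofIrrelevance.
Require Import Defs.

(* A PLIVF is determined by its value at the unit, so representing the Lie
   functor means giving a universal map i : g -> TG lying over the unit of G (a
   kernel of p), and tangent representability says that the iterates
   T i ;; c, ... are again universal.  By universality of the vertical lift and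
   division in the group TTG, the maps into TTG lying over the unit under Tp are
   exactly the products kappa(u, b) = (u i z)(b i l) for unique u, b into g.
   Hence T i ;; c is universal iff T i = kappa(p, q) for some q : Tg -> g making
   <p, q> : Tg -> g x g invertible.

   If T i ;; c is universal, this q is the map \hat p of a differential
   structure on g whose addition is the multiplication of TG; it is commutative
   by Eckmann-Hilton.  Its vertical lift v satisfies v ;; T i = i ;; l, and
   multilinearity of maps and of PLIVFs correspond because T i is monic.
   Conversely, if g is a differential object, multilinearity of the identity
   gives v ;; T i = i ;; l, whence T i = kappa(p, \hat p).  This last equation
   passes from (G, g) to (TG, Tg) by conjugation with c, so all iterates of i
   are universal. *)

Section Proposition.
Set Implicit Arguments.
Unset Strict Implicit.
Unset Printing Implicit Defensive.
Variable X : cartesian_tangent_category.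
Implicit Types D M N : X.

Notation pt := (tanp (T X)).
Notation zt := (tanz (T X)).
Notation lt := (tanl (T X)).
Notation ct := (tanc (T X)).
Notation Tm := (fmap (T X)).

(** * Fibrewise addition and the vertical lift *)

Lemma l_Tp M : lt M ;; Tm (pt M) = pt M ;; zt M.
Proof. exact: (am_q (ts_l_add (T X) M)). Qed.

Lemma l_p M : lt M ;; pt (T X M) = pt M ;; zt M.
Proof. by rewrite -{1}ts_lc -comp_assoc tanc_p l_Tp. Qed.

Lemma z_l M : zt M ;; lt M = zt M ;; zt (T X M).
Proof. by rewrite (am_zero (ts_l_add (T X) M) : _ = zt M ;; Tm (zt M)) tanz_nat. Qed.

Lemma c_Tp M : ct M ;; Tm (pt M) = pt (T X M).
Proof. by rewrite -tanc_p comp_assoc ts_cc comp_idl. Qed.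

(** The coherence [ts_lcc] rearranged by means of the involution [ct]; it carries the vertical
    component along when a splitting is transported by [T]. *)
Lemma Tl_c_Tc M : Tm (lt M) ;; ct (T X M) ;; Tm (ct M) = ct M ;; lt (T X M).
Proof.
rewrite -[Tm (lt M)]comp_idl -ts_cc -(comp_assoc (ct M)) -ts_lcc !comp_assoc.
rewrite -(comp_assoc _ (ct (T X M)) (ct _)) ts_cc comp_idr.
by rewrite -(comp_assoc _ (Tm _) (Tm _)) -fmap_comp ts_cc fmap_id comp_idr.
Qed.

Lemma fin2_ind (P : Fin.t 2 -> Prop) :
  P Fin.F1 -> P (Fin.FS Fin.F1) -> forall i, P i.
Proof.
move=> H1 H2 i; apply (Fin.caseS' i P H1) => j.
by apply (Fin.caseS' j (fun j => P (Fin.FS j)) H2) => k; inversion k.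
Qed.

Lemma tpi1_p M : tpi1 (T X) M ;; pt M = tanpow_p (T X) 2 M.
Proof. exact: (wp_comm (tanpow_pb (T X) 0 2 M) Fin.F1). Qed.

Lemma tpi2_p M : tpi2 (T X) M ;; pt M = tanpow_p (T X) 2 M.
Proof. exact: (wp_comm (tanpow_pb (T X) 0 2 M) (Fin.FS Fin.F1)). Qed.

Lemma tanpow2_uniq M D (u v : D ~> tanpow (T X) 2 M) :
  u ;; tpi1 (T X) M = v ;; tpi1 (T X) M ->
  u ;; tpi2 (T X) M = v ;; tpi2 (T X) M -> u = v.
Proof.
move=> H1 H2; apply: (wp_uniq (tanpow_pb (T X) 0 2 M)) => /=.
- exact: fin2_ind.
- by rewrite -tpi1_p !comp_assoc H1.
Qed.

Definition ppair M D (f g : D ~> T X M) (H : f ;; pt M = g ;; pt M) :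
  D ~> tanpow (T X) 2 M := bpair (B := p_bundle (T X) M) H.

Lemma ppair1 M D (f g : D ~> T X M) (H : f ;; pt M = g ;; pt M) :
  ppair H ;; tpi1 (T X) M = f.
Proof.
exact: (wp_med_pr (tanpow_pb (T X) 0 2 M)
  (two_over (B := p_bundle (T X) M) H) Fin.F1).
Qed.

Lemma ppair2 M D (f g : D ~> T X M) (H : f ;; pt M = g ;; pt M) :
  ppair H ;; tpi2 (T X) M = g.
Proof.
exact: (wp_med_pr (tanpow_pb (T X) 0 2 M)
  (two_over (B := p_bundle (T X) M) H) (Fin.FS Fin.F1)).
Qed.

Lemma ppair_zero M (H : (pt M ;; zt M) ;; pt M = idm (T X M) ;; pt M) :
  ppair H ;; tans (T X) M = idm (T X M).
Proof.
rewrite -[RHS](ab_unit (ts_add (T X) M)) /bplus.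
rewrite -/(ppair (bzero_fibre (p_bundle (T X) M))).
by congr (_ ;; _); apply: tanpow2_uniq; rewrite ?ppair1 ?ppair2.
Qed.

(* The graph of fibrewise addition: unlike [bplus], it carries no proof that
   the summands lie in the same fibre. *)
Definition is_sum M D (x y w : D ~> T X M) : Prop :=
  exists u : D ~> tanpow (T X) 2 M,
    u ;; tpi1 (T X) M = x /\ u ;; tpi2 (T X) M = y /\ u ;; tans (T X) M = w.

Lemma is_sum_fun M D (x y w w' : D ~> T X M) :
  is_sum x y w -> is_sum x y w' -> w = w'.
Proof.
move=> [u [<- [<- <-]]] [v [H1 [H2 <-]]].
by rewrite (tanpow2_uniq H1 H2).
Qed.

Lemma is_sum_nat M N D (f : M ~> N) (x y w : D ~> T X M) :
  is_sum x y w -> is_sum (x ;; Tm f) (y ;; Tm f) (w ;; Tm f).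
Proof.
move=> [u [<- [<- <-]]]; exists (u ;; tanpow_map (T X) 2 f).
have E i := wp_med_pr (tanpow_pb (T X) 0 2 N) (@tanpow_map_over _ (T X) 2 M N f) i.
split; [|split].
- by rewrite -comp_assoc (E Fin.F1) comp_assoc.
- by rewrite -comp_assoc (E (Fin.FS Fin.F1)) comp_assoc.
- by rewrite -comp_assoc -tans_nat comp_assoc.
Qed.

Lemma is_sum_fibre M D (x y w : D ~> T X M) :
  is_sum x y w -> x ;; pt M = y ;; pt M.
Proof.
move=> [u [<- [<- _]]]; by rewrite -!comp_assoc tpi1_p tpi2_p.
Qed.

Lemma p_z_p M : (pt M ;; zt M) ;; pt M = idm (T X M) ;; pt M.
Proof. by rewrite -comp_assoc tanz_p comp_idr comp_idl. Qed.

Lemma is_sum0l M D (x : D ~> T X M) : is_sum (x ;; pt M ;; zt M) x x.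
Proof.
exists (x ;; ppair (p_z_p M)).
by rewrite -!comp_assoc ppair1 ppair2 ppair_zero !comp_idr.
Qed.

Lemma is_sumC M D (x y w : D ~> T X M) : is_sum x y w -> is_sum y x w.
Proof.
move=> [u [<- [<- <-]]].
pose H12 : tpi1 (T X) M ;; pt M = tpi2 (T X) M ;; pt M :=
  bpr_eq (p_bundle (T X) M) _ _.
pose H21 : tpi2 (T X) M ;; pt M = tpi1 (T X) M ;; pt M :=
  bpr_eq (p_bundle (T X) M) _ _.
have E : ppair H12 ;; tans (T X) M = ppair H21 ;; tans (T X) M.
  exact: (ab_comm (ts_add (T X) M)).
exists (u ;; ppair H21); rewrite -!comp_assoc ppair1 ppair2 -E.
have -> : ppair H12 = idm _ by apply: tanpow2_uniq; rewrite ?ppair1 ?ppair2 comp_idl.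
by rewrite comp_idl.
Qed.

Lemma is_sum0r M D (x : D ~> T X M) : is_sum x (x ;; pt M ;; zt M) x.
Proof. exact/is_sumC/is_sum0l. Qed.

Lemma is_sum_ex M D (x y : D ~> T X M) :
  x ;; pt M = y ;; pt M -> exists w, is_sum x y w.
Proof.
move=> H; exists (ppair H ;; tans (T X) M), (ppair H).
by rewrite ppair1 ppair2.
Qed.

Lemma is_sum_pair M N D (x y w : D ~> T X M) (x' y' w' : D ~> T X N) :
  is_sum x y w -> is_sum x' y' w' ->
  is_sum (<| x, x' |> ;; Tprod X M N) (<| y, y' |> ;; Tprod X M N)
    (<| w, w' |> ;; Tprod X M N).
Proof.
move=> S S'.
have H : (<| x, x' |> ;; Tprod X M N) ;; pt (M ** N) =
         (<| y, y' |> ;; Tprod X M N) ;; pt (M ** N).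
  by apply: fp_pair_uniq; rewrite -!(comp_assoc _ (pt _)) !tanp_nat !comp_assoc
    ?Tprod1_comp ?Tprod2_comp ?fp_pair_pi1 ?fp_pair_pi2
    ?(is_sum_fibre S) ?(is_sum_fibre S').
(* Some sum exists because the summands share a fibre; naturality along the projections identifies
   it componentwise. *)
have [v Sv] := is_sum_ex H.
suff <- : v = <| w, w' |> ;; Tprod X M N by [].
apply: Tprod_uniq.
- have := is_sum_nat p1 Sv; rewrite !Tprod1_comp !fp_pair_pi1 => Sv1.
  exact: is_sum_fun Sv1 S.
- have := is_sum_nat p2 Sv; rewrite !Tprod2_comp !fp_pair_pi2 => Sv1.
  exact: is_sum_fun Sv1 S'.
Qed.

(** * Universality of the vertical lift *)

Lemma xi_pr M :
  exists r : tanpow (T X) 2 M ~> T X (tanpow (T X) 2 M),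
  [/\ xi (am_q (ts_l_add (T X) M)) = r ;; Tm (tans (T X) M),
      r ;; Tm (tpi1 (T X) M) = tpi1 (T X) M ;; zt (T X M) &
      r ;; Tm (tpi2 (T X) M) = tpi2 (T X) M ;; lt M].
Proof.
set H := xi_fibre (am_q (ts_l_add (T X) M)).
exists (bpair (B := Tp_bundle (T X) M) H); split=> //.
- exact: (wp_med_pr (tanpow_pb (T X) 1 2 M)
    (two_over (B := Tp_bundle (T X) M) H) Fin.F1).
- exact: (wp_med_pr (tanpow_pb (T X) 1 2 M)
    (two_over (B := Tp_bundle (T X) M) H) (Fin.FS Fin.F1)).
Qed.

(** The left unit law of fibrewise addition, transported by [T]: since [T] preserves the pullback,
    [r] must factor as [b] followed by the image of the pairing with zero. *)
Lemma Tsum0l M D (r : D ~> T X (tanpow (T X) 2 M)) (b : D ~> T X (T X M)) :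
  r ;; Tm (tpi1 (T X) M) = b ;; Tm (pt M) ;; Tm (zt M) ->
  r ;; Tm (tpi2 (T X) M) = b -> r ;; Tm (tans (T X) M) = b.
Proof.
move=> H1 H2.
have -> : r = b ;; Tm (ppair (p_z_p M)).
{ apply: (wp_uniq (tanpow_pb (T X) 1 2 M)) => /=.
  - apply: fin2_ind; rewrite -/(tpi1 _ _) -/(tpi2 _ _) -comp_assoc -fmap_comp.
      by rewrite ppair1 fmap_comp comp_assoc.
    by rewrite ppair2 fmap_id comp_idr.
  - rewrite -tpi2_p fmap_comp !comp_assoc H2; congr (_ ;; _).
    by rewrite -comp_assoc -fmap_comp ppair2 fmap_id comp_idr. }
by rewrite -comp_assoc -fmap_comp ppair_zero fmap_id comp_idr.
Qed.

Lemma xi_vertical M D (u : D ~> tanpow (T X) 2 M) (v : D ~> M) :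
  u ;; tpi1 (T X) M = v ;; zt M ->
  u ;; xi (am_q (ts_l_add (T X) M)) = u ;; tpi2 (T X) M ;; lt M.
Proof.
move=> Hu; have [r [-> r1 r2]] := xi_pr M; rewrite comp_assoc; apply: Tsum0l.
- rewrite -!comp_assoc r1 comp_assoc Hu.
  have Hp : u ;; (tpi2 (T X) M ;; pt M) = v.
    by rewrite tpi2_p -tpi1_p comp_assoc Hu -comp_assoc tanz_p comp_idr.
  rewrite (comp_assoc (lt M)) l_Tp -(comp_assoc (pt M)) tanz_nat.
  by rewrite !comp_assoc -(comp_assoc u) Hp.
- by rewrite -comp_assoc r2 comp_assoc.
Qed.

(** On pairs whose first component is a zero vector, [xi] restricts to the lift of the second
    component, so uniqueness in the pullback [ts_univ] applies. *)
Lemma l_mono M D (a b : D ~> T X M) : a ;; lt M = b ;; lt M -> a = b.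
Proof.
move=> H.
have Hp : a ;; pt M = b ;; pt M.
  have := f_equal (fun f => f ;; Tm (pt M) ;; pt M) H.
  by rewrite -!comp_assoc !(comp_assoc (lt M)) l_Tp -!comp_assoc tanz_p comp_idr.
have [u [Hu1 [Hu2 _]]] := is_sum0l a.
have [v [Hv1 [Hv2 _]]] := is_sum0l b.
rewrite -Hu2 -Hv2; congr (_ ;; _).
apply: (pb_uniq (ts_univ (T X) M)).
- by rewrite (xi_vertical Hu1) (xi_vertical Hv1) Hu2 Hv2.
- by rewrite !comp_assoc Hu1 Hv1 Hp.
Qed.

(** The hypothesis on [Tm (pt M)] factors [w] through [xi]; the one on [pt (T X M)] forces the first
    component of the factor to be zero, so that [xi] reduces to the lift. *)
Lemma l_fac M D (w : D ~> T X (T X M)) (v : D ~> M) :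
  w ;; Tm (pt M) = v ;; zt M -> w ;; pt (T X M) = v ;; zt M ->
  { b : D ~> T X M | b ;; lt M = w }.
Proof.
move=> HT Hp; pose P := ts_univ (T X) M.
exists (pb_med P HT ;; tpi2 (T X) M).
set u := pb_med P HT.
have Hw : u ;; xi _ = w := pb_med1 P HT.
have Hv : u ;; (tpi1 (T X) M ;; pt M) = v := pb_med2 P HT.
have Hu : u ;; tpi1 (T X) M = v ;; zt M; last by rewrite -(xi_vertical Hu) Hw.
(* Under [pt (T X M)] the sum defining [xi] becomes the first component plus the projection of a
   lift, which is a zero vector. *)
have [r [Er r1 r2]] := xi_pr M; rewrite -Hp -Hw Er.
rewrite -(comp_assoc u) -(comp_assoc r) -tanp_nat !comp_assoc.
have S : is_sum (u ;; r ;; pt _ ;; tpi1 (T X) M) (u ;; r ;; pt _ ;; tpi2 (T X) M)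
   (u ;; r ;; pt _ ;; tans (T X) M) by eexists; split; [|split].
apply/esym/(is_sum_fun S).
rewrite -!(comp_assoc _ (pt _)) !tanp_nat -!(comp_assoc u) !(comp_assoc r) r1 r2.
rewrite -(comp_assoc _ (zt _)) tanz_p comp_idr -(comp_assoc _ (lt _)) l_p.
have -> : u ;; (tpi2 (T X) M ;; (pt M ;; zt M)) = u ;; tpi1 (T X) M ;; pt M ;; zt M.
  by rewrite !comp_assoc -!(comp_assoc u) tpi1_p tpi2_p.
exact: is_sum0r.
Qed.

(** * Generalized elements of group objects *)

(* Group structures on a fixed carrier.  For [tangent_group G] the carrier is
   only convertible to [T X G]; here it is syntactically [T X M]. *)
Record grp M := Grp {
  mul : M ** M ~> M;
  unit : one ~> M;
  inv : M ~> M;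
  mulA : assoc M M M ;; prod_map mul (idm M) ;; mul = prod_map (idm M) mul ;; mul;
  mul1g : <| bang ;; unit, idm M |> ;; mul = idm M;
  mulg1 : <| idm M, bang ;; unit |> ;; mul = idm M;
  mulVg : <| inv, idm M |> ;; mul = bang ;; unit;
  mulgV : <| idm M, inv |> ;; mul = bang ;; unit
}.

Definition grp_of (G : group_object X) : grp G :=
  Grp (gmulA G) (gmul1g G) (gmulg1 G) (gmulVg G) (gmulgV G).

Definition tg M (H : grp M) : grp (T X M) :=
  grp_of (tangent_group
    (GroupObject (mulA H) (mul1g H) (mulg1 H) (mulVg H) (mulgV H))).

Section Elements.
Variables (M : X) (H : grp M).

Definition emul D (x y : D ~> M) : D ~> M := <| x, y |> ;; mul H.
Definition eunit D : D ~> M := bang ;; unit H.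

Lemma emul_comp D D' (h : D' ~> D) (x y : D ~> M) :
  h ;; emul x y = emul (h ;; x) (h ;; y).
Proof. by rewrite /emul comp_assoc pair_comp. Qed.

Lemma eunit_comp D D' (h : D' ~> D) : h ;; eunit D = eunit D'.
Proof. by rewrite /eunit comp_assoc; congr (_ ;; _); apply: fp_bang_uniq. Qed.

Lemma emulA D (x y w : D ~> M) : emul (emul x y) w = emul x (emul y w).
Proof.
have := f_equal (comp <| x, <| y, w |> |>) (mulA H).
rewrite /assoc /prod_map /emul.
by do 5 rewrite ?pair_comp ?comp_assoc ?fp_pair_pi1 ?fp_pair_pi2 ?comp_idr.
Qed.

Lemma emul1l D (x : D ~> M) : emul (eunit D) x = x.
Proof.
by rewrite -[RHS]comp_idr -(mul1g H) -/(eunit M) comp_assoc pair_comp eunit_comp comp_idr.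
Qed.

Lemma emul1r D (x : D ~> M) : emul x (eunit D) = x.
Proof.
by rewrite -[RHS]comp_idr -(mulg1 H) -/(eunit M) comp_assoc pair_comp eunit_comp comp_idr.
Qed.

Lemma emulVl D (x : D ~> M) : emul (x ;; inv H) x = eunit D.
Proof.
by rewrite -(eunit_comp x) /eunit -(mulVg H) comp_assoc pair_comp comp_idr.
Qed.

Lemma emulVr D (x : D ~> M) : emul x (x ;; inv H) = eunit D.
Proof.
by rewrite -(eunit_comp x) /eunit -(mulgV H) comp_assoc pair_comp comp_idr.
Qed.

Lemma emulKV D (x y : D ~> M) : emul x (emul (x ;; inv H) y) = y.
Proof. by rewrite -emulA emulVr emul1l. Qed.

Lemma emul_cancel D (x y y' : D ~> M) : emul x y = emul x y' -> y = y'.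
Proof. by move=> E; rewrite -(emul1l y) -(emul1l y') -(emulVl x) !emulA E. Qed.

Lemma emul_pi : emul p1 p2 = mul H.
Proof.
rewrite /emul; have -> : <| p1, p2 |> = idm (M ** M).
  by apply: fp_pair_uniq; rewrite ?fp_pair_pi1 ?fp_pair_pi2 comp_idl.
by rewrite comp_idl.
Qed.

End Elements.

(** * Group homomorphisms, and commutativity over the unit *)

Definition is_ghom M N (H : grp M) (K : grp N) (f : M ~> N) : Prop :=
  forall D (x y : D ~> M), emul H x y ;; f = emul K (x ;; f) (y ;; f).

Lemma ghom_e M N (H : grp M) (K : grp N) (f : M ~> N) D :
  is_ghom H K f -> eunit H D ;; f = eunit K D.
Proof.
move=> hf; apply: (@emul_cancel _ K _ (eunit H D ;; f)).
by rewrite -hf emul1l emul1r.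
Qed.

Lemma ghom_div M N (H : grp M) (K : grp N) (f : M ~> N) D (x y : D ~> M) :
  is_ghom H K f -> x ;; f = y ;; f -> emul H (x ;; inv H) y ;; f = eunit K D.
Proof. by move=> hf E; rewrite hf -E -hf emulVl (ghom_e _ hf). Qed.

Lemma emul_T M (H : grp M) D (x y : D ~> T X M) :
  emul (tg H) x y = <| x, y |> ;; Tprod X M M ;; Tm (mul H).
Proof. by rewrite -comp_assoc. Qed.

Lemma Temul M (H : grp M) D (x y : D ~> M) :
  Tm (emul H x y) = emul (tg H) (Tm x) (Tm y).
Proof. by rewrite emul_T -Tpair_map /emul fmap_comp. Qed.

Lemma Teunit M (H : grp M) D : Tm (eunit H D) = eunit (tg H) (T X D).
Proof. by rewrite /eunit fmap_comp Tbang -comp_assoc. Qed.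

(** Naturality at the multiplication and at the two projections suffices; [hom_z], [hom_l] and
    [hom_c] follow in the same way. *)
Lemma hom_p M (H : grp M) : is_ghom (tg H) H (pt M).
Proof.
move=> D x y; rewrite emul_T -comp_assoc -tanp_nat comp_assoc; congr (_ ;; _).
apply: fp_pair_uniq; rewrite -!(comp_assoc _ (pt _)) !tanp_nat !comp_assoc.
- by rewrite Tprod1_comp !fp_pair_pi1.
- by rewrite Tprod2_comp !fp_pair_pi2.
Qed.

Lemma hom_z M (H : grp M) : is_ghom H (tg H) (zt M).
Proof.
move=> D x y; rewrite emul_T /emul -comp_assoc -tanz_nat comp_assoc; congr (_ ;; _).
apply: Tprod_uniq; rewrite -(comp_assoc _ (zt _)) tanz_nat !comp_assoc.
- by rewrite Tprod1_comp !fp_pair_pi1.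
- by rewrite Tprod2_comp !fp_pair_pi2.
Qed.

Lemma hom_T M N (H : grp M) (K : grp N) (f : M ~> N) :
  is_ghom H K f -> is_ghom (tg H) (tg K) (Tm f).
Proof.
move=> hf D x y; rewrite emul_T -comp_assoc -fmap_comp -emul_pi hf Temul emul_comp.
by rewrite !fmap_comp !comp_assoc Tprod1_comp Tprod2_comp fp_pair_pi1 fp_pair_pi2.
Qed.

Lemma emul_TT M (H : grp M) D (x y : D ~> T X (T X M)) :
  emul (tg (tg H)) x y = <| x, y |> ;; Tprod X (T X M) (T X M)
     ;; Tm (Tprod X M M) ;; Tm (Tm (mul H)).
Proof. by rewrite emul_T /= fmap_comp comp_assoc. Qed.

Lemma TTprod1 M N :
  Tm (Tprod X M N) ;; Tm (Tm (fp_pi1 (ct_prod X) M N)) = Tm p1.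
Proof. by rewrite -fmap_comp Tprod1. Qed.

Lemma TTprod2 M N :
  Tm (Tprod X M N) ;; Tm (Tm (fp_pi2 (ct_prod X) M N)) = Tm p2.
Proof. by rewrite -fmap_comp Tprod2. Qed.

Lemma hom_l M (H : grp M) : is_ghom (tg H) (tg (tg H)) (lt M).
Proof.
move=> D x y; rewrite emul_TT emul_T -comp_assoc -tanl_nat comp_assoc; congr (_ ;; _).
apply: TTprod_uniq; rewrite -!(comp_assoc _ (lt _)) tanl_nat
  -!(comp_assoc _ (Tm (Tprod _ _ _))).
- by rewrite TTprod1 !comp_assoc !Tprod1_comp !fp_pair_pi1.
- by rewrite TTprod2 !comp_assoc !Tprod2_comp !fp_pair_pi2.
Qed.

Lemma hom_c M (H : grp M) : is_ghom (tg (tg H)) (tg (tg H)) (ct M).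
Proof.
move=> D x y; rewrite !emul_TT -comp_assoc -tanc_nat comp_assoc; congr (_ ;; _).
apply: TTprod_uniq; rewrite -!(comp_assoc _ (ct _)) tanc_nat !comp_assoc
  -!(comp_assoc _ (Tm (Tprod _ _ _))).
- by rewrite TTprod1 ?comp_assoc !Tprod1_comp !fp_pair_pi1.
- by rewrite TTprod2 ?comp_assoc !Tprod2_comp !fp_pair_pi2.
Qed.

(* Eckmann-Hilton: over the unit, fibrewise addition and the multiplication
   of [T X M] have the same unit and satisfy the interchange law. *)
Lemma is_sum_emul M (H : grp M) D (x y w x' y' w' : D ~> T X M) :
  is_sum x y w -> is_sum x' y' w' ->
  is_sum (emul (tg H) x x') (emul (tg H) y y') (emul (tg H) w w').
Proof.
by move=> S S'; rewrite !emul_T; apply/is_sum_nat/is_sum_pair.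
Qed.

Lemma is_sum_e M (H : grp M) D (x : D ~> T X M) :
  x ;; pt M = eunit H D -> is_sum (eunit (tg H) D) x x /\ is_sum x (eunit (tg H) D) x.
Proof.
move=> E; have <- : x ;; pt M ;; zt M = eunit (tg H) D.
  by rewrite E (ghom_e _ (hom_z H)).
by split; [exact: is_sum0l | exact: is_sum0r].
Qed.

(** Interchange applied to [x + 0 = x] and [0 + y = y], where the zero over the unit is the unit of
    [tg H]. *)
Lemma is_sum_mul M (H : grp M) D (x y : D ~> T X M) :
  x ;; pt M = eunit H D -> y ;; pt M = eunit H D -> is_sum x y (emul (tg H) x y).
Proof.
move=> /is_sum_e [_ Hx] /is_sum_e [Hy _].
by have := is_sum_emul H Hx Hy; rewrite emul1l emul1r.
Qed.

Lemma emulC_p M (H : grp M) D (x y : D ~> T X M) :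
  x ;; pt M = eunit H D -> y ;; pt M = eunit H D -> emul (tg H) x y = emul (tg H) y x.
Proof.
move=> Hx Hy; apply: (is_sum_fun (is_sum_mul Hx Hy)).
have [S _] := is_sum_e Hx; have [_ S'] := is_sum_e Hy.
by have := is_sum_emul H S' S; rewrite emul1l emul1r => /is_sumC.
Qed.

(** The involution [ct M] is a homomorphism exchanging the kernels of [Tm (pt M)] and [pt (T X M)],
    which reduces the claim to [emulC_p]. *)
Lemma emulC_Tp M (H : grp M) D (x y : D ~> T X (T X M)) :
  x ;; Tm (pt M) = eunit (tg H) D -> y ;; Tm (pt M) = eunit (tg H) D ->
  emul (tg (tg H)) x y = emul (tg (tg H)) y x.
Proof.
move=> Hx Hy.
have K (u : D ~> T X (T X M)) : u = u ;; ct M ;; ct M.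
  by rewrite -comp_assoc ts_cc comp_idr.
rewrite (K (emul _ x y)) (K (emul _ y x)); congr (_ ;; _); rewrite !(hom_c H).
by apply: emulC_p; rewrite -comp_assoc tanc_p.
Qed.

(** * Kernels of p and of Tp *)

(** The tangent space at the unit. Factorizations are data rather than mere existence, because
    [hat], the addition on [g] and the representations are extracted from them. *)
Record kernel M (H : grp M) (g : X) := Kernel {
  incl : g ~> T X M;
  incl_p : incl ;; pt M = eunit H g;
  incl_fac : forall D (y : D ~> T X M), y ;; pt M = eunit H D -> {u : D ~> g | u ;; incl = y};
  incl_mono : forall D (u v : D ~> g), u ;; incl = v ;; incl -> u = v
}.

Section Kappa.
Variables (M : X) (H : grp M) (g : X) (K : kernel H g).

Let TH := tg H.
Let TTH := tg (tg H).

(* In [T g = g x g], [u] is the base point and [b] the vertical component. *)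
Definition kappa D (u b : D ~> g) : D ~> T X (T X M) :=
  emul (tg (tg H)) (u ;; incl K ;; zt (T X M)) (b ;; incl K ;; lt M).

Lemma incl_comp_p D (u : D ~> g) : u ;; incl K ;; pt M = eunit H D.
Proof. by rewrite -comp_assoc incl_p eunit_comp. Qed.

Lemma eunit_z D : eunit H D ;; zt M = eunit TH D.
Proof. exact: ghom_e (hom_z H). Qed.

Lemma incl_z_p D (u : D ~> g) : u ;; incl K ;; zt (T X M) ;; pt (T X M) = u ;; incl K.
Proof. by rewrite -comp_assoc tanz_p comp_idr. Qed.

Lemma incl_z_Tp D (u : D ~> g) : u ;; incl K ;; zt (T X M) ;; Tm (pt M) = eunit TH D.
Proof. by rewrite -comp_assoc tanz_nat comp_assoc incl_comp_p eunit_z. Qed.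

Lemma incl_l_p D (u : D ~> g) : u ;; incl K ;; lt M ;; pt (T X M) = eunit TH D.
Proof. by rewrite -comp_assoc l_p comp_assoc incl_comp_p eunit_z. Qed.

Lemma incl_l_Tp D (u : D ~> g) : u ;; incl K ;; lt M ;; Tm (pt M) = eunit TH D.
Proof. by rewrite -comp_assoc l_Tp comp_assoc incl_comp_p eunit_z. Qed.

Lemma kappa_comp D D' (h : D' ~> D) (u b : D ~> g) :
  h ;; kappa u b = kappa (h ;; u) (h ;; b).
Proof. by rewrite /kappa emul_comp !comp_assoc. Qed.

Lemma kappa_p D (u b : D ~> g) : kappa u b ;; pt (T X M) = u ;; incl K.
Proof. by rewrite (hom_p TH) incl_z_p incl_l_p emul1r. Qed.

(** Projecting by [pt (T X M)] recovers [u]; cancelling the first factor then leaves [b] followed by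
    two monic maps. *)
Lemma kappa_inj D (u b u' b' : D ~> g) :
  kappa u b = kappa u' b' -> u = u' /\ b = b'.
Proof.
move=> E; have Eu : u = u' by apply: (incl_mono (k := K)); rewrite -(kappa_p u b) E kappa_p.
split=> //; subst u'; apply/(incl_mono (k := K))/l_mono/(emul_cancel E).
Qed.

Lemma kappa_fac D (y : D ~> T X (T X M)) :
  y ;; Tm (pt M) = eunit TH D -> { ub : (D ~> g) * (D ~> g) | kappa ub.1 ub.2 = y }.
Proof.
move=> Hy.
have Hyp : y ;; pt (T X M) ;; pt M = eunit H D.
  by rewrite -comp_assoc tanp_nat comp_assoc Hy (ghom_e _ (hom_p H)).
have [u Hu] := incl_fac K Hyp.
(* Dividing [y] by the zero vector at its base point gives an element over the unit under both
   projections, hence a vertical lift. *)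
set x := u ;; incl K ;; zt (T X M); set w := emul TTH (x ;; inv TTH) y.
have w_p : w ;; pt (T X M) = eunit H D ;; zt M.
  by rewrite eunit_z; apply: (ghom_div (hom_p TH)); rewrite incl_z_p.
have w_Tp : w ;; Tm (pt M) = eunit H D ;; zt M.
  by rewrite eunit_z; apply: (ghom_div (hom_T (hom_p H))); rewrite incl_z_Tp.
have [v Hv] := l_fac w_Tp w_p.
have v_p : v ;; pt M = eunit H D.
  rewrite -[LHS]comp_idr -(tanz_p (T X)) comp_assoc -(comp_assoc v) -l_p.
  rewrite comp_assoc Hv w_p.
  by rewrite -comp_assoc tanz_p comp_idr.
have [b Hb] := incl_fac K v_p.
by exists (u, b); rewrite /kappa /= Hb Hv /w emulKV.
Qed.

Lemma kappa0z D (u : D ~> g) (o : D ~> g) : o ;; incl K = eunit TH D ->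
  kappa u o = u ;; incl K ;; zt (T X M).
Proof. by move=> Ho; rewrite /kappa Ho (ghom_e _ (hom_l H)) emul1r. Qed.

Lemma kappa0l D (b : D ~> g) (o : D ~> g) : o ;; incl K = eunit TH D ->
  kappa o b = b ;; incl K ;; lt M.
Proof. by move=> Ho; rewrite /kappa Ho (ghom_e _ (hom_z TH)) emul1l. Qed.

(** In the product of four factors the two middle ones commute, as both lie in the kernel of
    [Tm (pt M)]. *)
Lemma kappa_add D (u b u' b' u2 b2 : D ~> g) :
  u2 ;; incl K = emul TH (u ;; incl K) (u' ;; incl K) ->
  b2 ;; incl K = emul TH (b ;; incl K) (b' ;; incl K) ->
  emul TTH (kappa u b) (kappa u' b') = kappa u2 b2.
Proof.
move=> Eu Eb; rewrite /kappa Eu Eb (hom_z TH) (hom_l H) !emulA; congr (emul _ _ _).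
rewrite -!emulA; congr (emul _ _ _); apply: emulC_Tp; by rewrite ?incl_z_Tp ?incl_l_Tp.
Qed.

Lemma Tincl_Tp : Tm (incl K) ;; Tm (pt M) = eunit TH (T X g).
Proof. by rewrite -fmap_comp incl_p Teunit. Qed.

(** Coordinates on [T X g] matching those of [kappa]. They make [Tm (incl K) ;; ct M] a kernel
    again, and they are inherited by that kernel. *)
Record splitting := Splitting {
  split_hat : T X g ~> g;
  split_pair : g ** g ~> T X g;
  split_pairK : split_pair ;; <| pt g, split_hat |> = idm _;
  split_pairVK : <| pt g, split_hat |> ;; split_pair = idm _;
  split_incl : Tm (incl K) = kappa (pt g) split_hat
}.

Section KernelT.
Variable S : splitting.

Lemma Tincl_c_p : (Tm (incl K) ;; ct M) ;; pt (T X M) = eunit TH (T X g).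
Proof. by rewrite -comp_assoc tanc_p Tincl_Tp. Qed.

(** Composing with [ct M] moves [y] into the kernel of [Tm (pt M)], where [kappa_fac] supplies two
    coordinates; [split_pair] assembles them into a map to [T X g]. *)
Lemma Tincl_c_fac D (y : D ~> T X (T X M)) :
  y ;; pt (T X M) = eunit TH D -> {t : D ~> T X g | t ;; (Tm (incl K) ;; ct M) = y}.
Proof.
move=> Hy; have Hy' : y ;; ct M ;; Tm (pt M) = eunit TH D.
  by rewrite -comp_assoc c_Tp.
have [[u b] /= E] := kappa_fac Hy'.
exists (<| u, b |> ;; split_pair S).
rewrite comp_assoc (split_incl S) kappa_comp -!(comp_assoc _ (split_pair S)).
have Es := split_pairK S; rewrite pair_comp in Es.
have -> : split_pair S ;; pt g = p1 by rewrite -(comp_idl p1) -Es fp_pair_pi1.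
have -> : split_pair S ;; split_hat S = p2 by rewrite -(comp_idl p2) -Es fp_pair_pi2.
by rewrite fp_pair_pi1 fp_pair_pi2 E -comp_assoc ts_cc comp_idr.
Qed.

Lemma Tincl_c_mono D (u v : D ~> T X g) :
  u ;; (Tm (incl K) ;; ct M) = v ;; (Tm (incl K) ;; ct M) -> u = v.
Proof.
move=> E; have {}E := f_equal (fun f => f ;; ct M) E.
rewrite -!comp_assoc ts_cc comp_idr (split_incl S) !kappa_comp in E.
have [E1 E2] := kappa_inj E.
by rewrite -[u]comp_idr -[v]comp_idr -(split_pairVK S) !comp_assoc !pair_comp E1 E2.
Qed.

Definition kernelT : kernel (tg H) (T X g) :=
  Kernel Tincl_c_p Tincl_c_fac Tincl_c_mono.

End KernelT.
End Kappa.

(** Applying [T] to the old coordinates gives first coordinate [Tm (pt g)]; precomposition with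
    [ct g] turns it into [pt (T X g)], whence the new second coordinate
    [ct g ;; Tm (split_hat S)]. *)
Lemma splitT_K M (H : grp M) g (K : kernel H g) (S : splitting K) :
  (Tprod X g g ;; Tm (split_pair S) ;; ct g) ;; <| pt (T X g), ct g ;; Tm (split_hat S) |> = idm _.
Proof.
rewrite -comp_assoc pair_comp comp_assoc ts_cc comp_idl tanc_p -comp_assoc.
rewrite pair_comp -!fmap_comp.
have Es := split_pairK S; rewrite pair_comp in Es.
have -> : split_pair S ;; pt g = p1 by rewrite -(comp_idl p1) -Es fp_pair_pi1.
have -> : split_pair S ;; split_hat S = p2 by rewrite -(comp_idl p2) -Es fp_pair_pi2.
exact: TprodK.
Qed.

Lemma splitT_VK M (H : grp M) g (K : kernel H g) (S : splitting K) :
  <| pt (T X g), ct g ;; Tm (split_hat S) |> ;; (Tprod X g g ;; Tm (split_pair S) ;; ct g) = idm _.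
Proof.
rewrite -c_Tp -pair_comp !comp_assoc -(comp_assoc (ct g)) -Tpair_map.
by rewrite -(comp_assoc (ct g)) -fmap_comp (split_pairVK S) fmap_id comp_idr ts_cc.
Qed.

(** Conjugating the image of [split_incl] under [T] by homomorphisms built from [ct] treats the two
    factors separately: [tanz_c] and naturality settle the zero part, [Tl_c_Tc] the vertical
    part. *)
Lemma splitT_incl M (H : grp M) g (K : kernel H g) (S : splitting K) :
  Tm (incl (kernelT S)) = kappa (kernelT S) (pt (T X g)) (ct g ;; Tm (split_hat S)).
Proof.
rewrite /kappa /= fmap_comp.
have -> : Tm (Tm (incl K)) ;; Tm (ct M) =
  ct g ;; Tm (Tm (incl K)) ;; ct (T X M) ;; Tm (ct M).
  by rewrite tanc_nat -(comp_assoc _ (ct _) (ct _)) ts_cc comp_idr.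
rewrite {1}(split_incl S) /kappa Temul emul_comp (hom_c (tg H)) (hom_T (hom_c H)).
rewrite !fmap_comp !comp_assoc c_Tp; congr (emul _ _ _).
- by rewrite -(comp_assoc _ _ (ct (T X M))) tanz_c
    -!(comp_assoc _ _ (Tm (ct M))) tanz_nat !comp_assoc.
- by rewrite -(comp_assoc _ _ (ct (T X M))) -(comp_assoc _ _ (Tm (ct M)))
    Tl_c_Tc !comp_assoc.
Qed.

Definition splittingT M (H : grp M) g (K : kernel H g) (S : splitting K) :
  splitting (kernelT S) := Splitting (splitT_K S) (splitT_VK S) (splitT_incl S).

(** * PLIVFs and their values at the unit *)

Section Lie.
Variable G : group_object X.
Let H := grp_of G.

Definition at_unit A (V : PLIVF G A) : A ~> T X G :=
  <| eunit H A, idm A |> ;; proj1_sig V.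

Lemma at_unit_p A (V : PLIVF G A) : at_unit V ;; pt G = eunit H A.
Proof.
by rewrite /at_unit -comp_assoc (proj1 (proj2_sig V)) fp_pair_pi1.
Qed.

Lemma at_unit_map A B (f : A ~> B) (V : PLIVF G B) : at_unit (lie_map f V) = f ;; at_unit V.
Proof.
rewrite /at_unit /= /prod_map !comp_assoc !pair_comp eunit_comp !comp_assoc.
by rewrite fp_pair_pi1 fp_pair_pi2 !comp_idr comp_idl.
Qed.

(** Left invariance evaluated with the unit as second group element: [V] is the left translate of
    its value at the unit. *)
Lemma PLIVF_at_unit A (V : PLIVF G A) :
  proj1_sig V = emul (tg H) (p1 ;; zt G) (p2 ;; at_unit V).
Proof.
have -> : fp_pi2 (ct_prod X) G A ;; at_unit V = <| eunit H _, p2 |> ;; proj1_sig V.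
  by rewrite /at_unit comp_assoc pair_comp eunit_comp comp_idr.
rewrite emul_T; have := f_equal (comp <| p1, <| eunit H _, p2 |> |>) (proj2 (proj2_sig V)).
have := emul1r H (fp_pi1 (ct_prod X) G A); rewrite /emul.
move: (eunit H (G ** A)) => e E; rewrite /assoc /prod_map.
do 5 rewrite ?pair_comp ?comp_assoc ?fp_pair_pi1 ?fp_pair_pi2 ?comp_idr; rewrite E.
have -> : <| p1, p2 |> = idm (G ** A).
  by apply: fp_pair_uniq; rewrite ?fp_pair_pi1 ?fp_pair_pi2 comp_idl.
by rewrite comp_idl.
Qed.

Lemma at_unit_inj A (V W : PLIVF G A) : at_unit V = at_unit W -> V = W.
Proof.
move=> E; have : proj1_sig V = proj1_sig W by rewrite !PLIVF_at_unit E.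
by case: V W {E} => [V HV] [W HW] /= E; apply: subset_eq_compat.
Qed.

Lemma translate_proof A (y : A ~> T X G) (Hy : y ;; pt G = eunit H A) :
  is_PLIVF (emul (tg H) (p1 ;; zt G) (p2 ;; y)).
Proof.
split.
- by rewrite (hom_p H) -!comp_assoc tanz_p comp_idr Hy eunit_comp emul1r.
(* On elements, [w] sends [(x, (y, a))] to [(x y, a)]. *)
- set w := assoc G G A ;; _.
  have w1 : w ;; p1 = emul H p1 (p2 ;; p1).
    rewrite /w /assoc /prod_map /emul.
    by do 3 rewrite ?pair_comp ?comp_assoc ?fp_pair_pi1 ?fp_pair_pi2.
  have w2 : w ;; p2 = p2 ;; p2.
    rewrite /w /assoc /prod_map.
    by do 3 rewrite ?pair_comp ?comp_assoc ?fp_pair_pi1 ?fp_pair_pi2 ?comp_idr.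
  transitivity (emul (tg H) (p1 ;; zt G) (p2 ;; emul (tg H) (p1 ;; zt G) (p2 ;; y))).
    by rewrite !emul_comp !(comp_assoc w) !(comp_assoc p2) w1 w2 (hom_z H) emulA.
  by [].
Qed.

Definition translate A (y : A ~> T X G) (Hy : y ;; pt G = eunit H A) : PLIVF G A :=
  exist _ _ (translate_proof Hy).

Lemma at_unit_translate A (y : A ~> T X G) (Hy : y ;; pt G = eunit H A) : at_unit (translate Hy) = y.
Proof.
rewrite /at_unit /= emul_comp !comp_assoc fp_pair_pi1 fp_pair_pi2 comp_idl.
by rewrite (ghom_e _ (hom_z H)) emul1l.
Qed.

(** * Passage between kernels and representations *)

Section RepKernel.
Variables (g : X) (K : kernel H g).

Lemma kernel_rep_p A (f : A ~> g) : (f ;; incl K) ;; pt G = eunit H A.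
Proof. exact: incl_comp_p. Qed.

Definition kernel_fun A (V : PLIVF G A) : A ~> g := proj1_sig (incl_fac K (at_unit_p V)).

Lemma kernel_funE A (V : PLIVF G A) : kernel_fun V ;; incl K = at_unit V.
Proof. exact: (proj2_sig (incl_fac K (at_unit_p V))). Qed.

Lemma kernel_funK A (V : PLIVF G A) : translate (kernel_rep_p (kernel_fun V)) = V.
Proof. by apply: at_unit_inj; rewrite at_unit_translate kernel_funE. Qed.

Lemma kernel_invK A (f : A ~> g) : kernel_fun (translate (kernel_rep_p f)) = f.
Proof. by apply: (incl_mono (k := K)); rewrite kernel_funE at_unit_translate. Qed.

Lemma kernel_nat A B (f : A ~> B) (V : PLIVF G B) :
  kernel_fun (lie_map f V) = f ;; kernel_fun V.
Proof.
by apply: (incl_mono (k := K)); rewrite kernel_funE at_unit_map -comp_assoc kernel_funE.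
Qed.

Definition kernel_rep : representation G g :=
  Representation kernel_funK kernel_invK kernel_nat.

End RepKernel.

Section KernelRep.
Variables (g : X) (phi : representation G g).

(** The universal PLIVF of the Yoneda lemma, evaluated at the unit. *)
Definition rep_incl : g ~> T X G := at_unit (rep_inv phi (idm g)).

Lemma rep_inclE A (V : PLIVF G A) : phi A V ;; rep_incl = at_unit V.
Proof.
rewrite /rep_incl -at_unit_map; congr at_unit.
by rewrite -[LHS](rep_funK phi) rep_nat rep_invK comp_idr rep_funK.
Qed.

Lemma rep_incl_fac D (y : D ~> T X G) :
  y ;; pt G = eunit H D -> {u : D ~> g | u ;; rep_incl = y}.
Proof. by move=> Hy; exists (phi D (translate Hy)); rewrite rep_inclE at_unit_translate. Qed.

Lemma rep_incl_mono D (u v : D ~> g) : u ;; rep_incl = v ;; rep_incl -> u = v.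
Proof.
rewrite -(rep_invK phi u) -(rep_invK phi v) !rep_inclE => E.
by rewrite (at_unit_inj E).
Qed.

Definition rep_kernel : kernel H g := Kernel (at_unit_p _) rep_incl_fac rep_incl_mono.

End KernelRep.

(** The left side is [at_unit (tau V)] up to conversion, written with [tg H]. Thus [tau] acts on
    values at the unit by applying [T] and composing with [ct G]. *)
Lemma at_unit_tau A (V : PLIVF G A) :
  <| eunit (tg H) (T X A), idm (T X A) |> ;; proj1_sig (tau V) = Tm (at_unit V) ;; ct G.
Proof.
rewrite /= !comp_assoc /at_unit fmap_comp Tpair_map Teunit fmap_id; reflexivity.
Qed.

(** One direction restricts to the unit. For the other, [V] is a left translate, and both sides are
    compared factor by factor through homomorphisms. *)
Lemma multilinear_PLIVF_at_unit l (V : PLIVF G (diff_prod l)) :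
  multilinear_PLIVF l V <->
  (forall k, k < length l -> diff_lift k l ;; Tm (at_unit V) = at_unit V ;; lt G).
Proof.
split=> hV k hk.
- have := f_equal (comp <| eunit H _, idm _ |>) (hV k hk).
  rewrite /at_unit fmap_comp !comp_assoc => <-.
  rewrite Tpair_map Teunit fmap_id (comp_assoc (diff_lift k l)) pair_comp eunit_comp comp_idr.
  do 2 congr (_ ;; _); rewrite /prod_map pair_comp !comp_assoc fp_pair_pi1 fp_pair_pi2.
  by rewrite comp_idl (ghom_e _ (hom_z H)).
- rewrite PLIVF_at_unit; move: (at_unit V) {hV} (hV k hk) => r hr.
  rewrite (hom_l H) Temul emul_comp !fmap_comp !comp_assoc !Tprod1_comp !Tprod2_comp.
  rewrite /prod_map fp_pair_pi1 fp_pair_pi2; congr (emul _ _ _).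
  + by rewrite -!comp_assoc z_l tanz_nat.
  + by rewrite -(comp_assoc _ (diff_lift k l)) hr comp_assoc.
Qed.

End Lie.

(** * From tangent to differentiable representability *)

Section DiffOfTangent.
Variables (M : X) (H : grp M) (g : X) (K : kernel H g).
Variables (K1 : kernel (tg H) (T X g)) (hK1 : incl K1 = Tm (incl K) ;; ct M).
Let TH := tg H.
Let TTH := tg (tg H).
Let i := incl K.

Lemma Ti_mono D (u v : D ~> T X g) : u ;; Tm i = v ;; Tm i -> u = v.
Proof. by move=> E; apply: (incl_mono (k := K1)); rewrite hK1 !comp_assoc E. Qed.

(** The vertical [kappa]-coordinate of [Tm i]; the other coordinate turns out to be [pt g]. *)
Definition hat : T X g ~> g := (proj1_sig (kappa_fac K (Tincl_Tp K))).2.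

Lemma Ti_kappa : Tm i = kappa K (pt g) hat.
Proof.
rewrite /hat; case: (kappa_fac _ _) => -[u b] /= E.
have <- : u = pt g; last by [].
by apply: (incl_mono (k := K)); rewrite tanp_nat -E kappa_p.
Qed.

(** The tool for the axioms on [hat]: to compute [t ;; hat], write [t ;; Tm i] in the form
    [kappa K u b]. *)
Lemma Ti_char D (t : D ~> T X g) (u b : D ~> g) :
  t ;; Tm i = kappa K u b -> t ;; pt g = u /\ t ;; hat = b.
Proof. by rewrite Ti_kappa kappa_comp; exact: kappa_inj. Qed.

Lemma lie_zero_ex : { o : one ~> g | o ;; i = eunit TH one }.
Proof. by apply: incl_fac; rewrite (ghom_e _ (hom_p H)). Qed.
Definition lie_zero := proj1_sig lie_zero_ex.

Lemma lie_zeroE D : (bang ;; lie_zero) ;; i = eunit TH D.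
Proof. by rewrite -comp_assoc (proj2_sig lie_zero_ex) eunit_comp. Qed.

Lemma lie_add_ex : { a : g ** g ~> g | a ;; i = emul TH (p1 ;; i) (p2 ;; i) }.
Proof. by apply: incl_fac; rewrite (hom_p H) !incl_comp_p emul1l. Qed.
Definition lie_add := proj1_sig lie_add_ex.

Lemma lie_addE D (x y : D ~> g) :
  (<| x, y |> ;; lie_add) ;; i = emul TH (x ;; i) (y ;; i).
Proof.
by rewrite -comp_assoc (proj2_sig lie_add_ex) emul_comp !comp_assoc fp_pair_pi1 fp_pair_pi2.
Qed.

Lemma hsplit_ex : { s : g ** g ~> T X g | s ;; Tm i = kappa K p1 p2 }.
Proof.
(* After [ct M] the universal [kappa] lies over the unit, so it factors through the kernel [K1]. *)
have H1 : kappa K p1 p2 ;; ct M ;; pt (T X M) = eunit TH (g ** g).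
  by rewrite -comp_assoc tanc_p (hom_T (hom_p H)) incl_z_Tp incl_l_Tp emul1l.
move: (kappa K _ _) H1 => y H1; have [s Hs] := incl_fac K1 H1; exists s.
have := f_equal (fun f => f ;; ct M) Hs.
by rewrite hK1 -!comp_assoc ts_cc !comp_idr.
Qed.
Definition hsplit := proj1_sig hsplit_ex.

Lemma hsplitK : hsplit ;; <| pt g, hat |> = idm _.
Proof.
have [E1 E2] := Ti_char (proj2_sig hsplit_ex).
by apply: fp_pair_uniq; rewrite -comp_assoc ?fp_pair_pi1 ?fp_pair_pi2 comp_idl.
Qed.

Lemma hsplitVK : <| pt g, hat |> ;; hsplit = idm _.
Proof.
apply: Ti_mono; rewrite -comp_assoc (proj2_sig hsplit_ex) kappa_comp.
by rewrite fp_pair_pi1 fp_pair_pi2 -Ti_kappa comp_idl.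
Qed.

Lemma lie_addA :
  assoc g g g ;; prod_map lie_add (idm g) ;; lie_add =
  prod_map (idm g) lie_add ;; lie_add.
Proof.
apply: (incl_mono (k := K)); rewrite /assoc /prod_map.
rewrite !pair_comp !comp_assoc !lie_addE !fp_pair_pi1 !fp_pair_pi2 !comp_idr.
rewrite !lie_addE.
have -> : p2 ;; lie_add = <| fp_pi2 (ct_prod X) g (g ** g) ;; p1, p2 ;; p2 |> ;; lie_add.
  rewrite -pair_comp; congr (_ ;; _).
  by rewrite -[LHS]comp_idr; congr (_ ;; _); apply: fp_pair_uniq;
    rewrite ?fp_pair_pi1 ?fp_pair_pi2 comp_idl.
by rewrite lie_addE emulA.
Qed.

Lemma lie_addC : <| p2, p1 |> ;; lie_add = lie_add.
Proof.
apply: (incl_mono (k := K)); rewrite lie_addE (proj2_sig lie_add_ex).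
by apply: emulC_p; rewrite incl_comp_p.
Qed.

Lemma lie_add0 : <| bang ;; lie_zero, idm g |> ;; lie_add = idm g.
Proof.
by apply: (incl_mono (k := K)); rewrite lie_addE lie_zeroE emul1l.
Qed.

Lemma hat_z : zt g ;; hat = bang ;; lie_zero.
Proof.
apply: (proj2 (@Ti_char _ _ (idm g) _ _)).
by rewrite tanz_nat (kappa0z _ (lie_zeroE g)) comp_idl.
Qed.

(** Interchange again: the zero parts add to themselves, while the lifts lie over the unit, where
    addition is multiplication. *)
Lemma is_sum_kappa D (a b b' : D ~> g) :
  is_sum (kappa K a b) (kappa K a b') (kappa K a (<| b, b' |> ;; lie_add)).
Proof.
rewrite /kappa lie_addE (hom_l H); apply: is_sum_emul.
- by rewrite -{1}(incl_z_p K a); exact: is_sum0l.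
- by apply: is_sum_mul; rewrite incl_l_p.
Qed.

Lemma hat_s : tans (T X) g ;; hat =
  <| tpi1 (T X) g ;; hat, tpi2 (T X) g ;; hat |> ;; lie_add.
Proof.
apply: (proj2 (@Ti_char _ _ (tpi1 (T X) g ;; pt g) _ _)).
have S : is_sum (tpi1 (T X) g) (tpi2 (T X) g) (tans (T X) g).
  by exists (idm _); rewrite !comp_idl.
apply: (is_sum_fun (is_sum_nat i S)).
rewrite Ti_kappa !kappa_comp (tpi2_p g) -(tpi1_p g); exact: is_sum_kappa.
Qed.

Lemma hat_zero : Tone X ;; Tm lie_zero ;; hat = lie_zero.
Proof.
apply: (proj2 (@Ti_char _ _ lie_zero _ _)).
rewrite -comp_assoc -fmap_comp (proj2_sig lie_zero_ex) Teunit eunit_comp.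
rewrite (kappa0z _ (proj2_sig lie_zero_ex)) (proj2_sig lie_zero_ex).
by rewrite (ghom_e _ (hom_z TH)).
Qed.

Lemma hat_add : Tprod X g g ;; Tm lie_add ;; hat = prod_map hat hat ;; lie_add.
Proof.
apply: (proj2 (@Ti_char _ _ (<| p1 ;; pt g, p2 ;; pt g |> ;; lie_add) _ _)).
rewrite -comp_assoc -fmap_comp (proj2_sig lie_add_ex) Temul emul_comp !fmap_comp.
rewrite !comp_assoc Tprod1 Tprod2 Ti_kappa !kappa_comp.
by apply: kappa_add; exact: lie_addE.
Qed.

(** Naturality of [lt] at [i] equates two products with a common first factor. Cancelling it leaves
    [w ;; hat] and [hat], each followed by [i] and two lifts, all monic. *)
Lemma hat_l : lt g ;; Tm hat ;; hat = hat.
Proof.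
set w := lt g ;; Tm hat.
have w_p : w ;; pt g = bang ;; lie_zero.
  rewrite /w -comp_assoc -tanp_nat comp_assoc l_p -comp_assoc hat_z comp_assoc.
  by congr (_ ;; _); apply: fp_bang_uniq.
have wi : w ;; Tm i = w ;; hat ;; i ;; lt M.
  by rewrite {1}Ti_kappa kappa_comp w_p (kappa0l _ (lie_zeroE _)).
have E := tanl_nat (T X) i.
have E2 : Tm i ;; lt (T X M) =
  emul (tg TTH) (pt g ;; i ;; zt (T X M) ;; zt (T X (T X M)))
    (hat ;; i ;; lt M ;; lt (T X M)).
  by rewrite Ti_kappa (hom_l TH) -(comp_assoc _ (zt _)) z_l comp_assoc.
have E1 : lt g ;; Tm (Tm i) =
  emul (tg TTH) (pt g ;; i ;; zt (T X M) ;; zt (T X (T X M)))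
    (w ;; hat ;; i ;; lt M ;; lt (T X M)).
  rewrite -(comp_assoc _ (lt M)) -ts_ll (comp_assoc _ (lt M)) -wi.
  rewrite {1}Ti_kappa Temul emul_comp !fmap_comp !comp_assoc -/i l_Tp -/w.
  congr (emul _ _ _).
  by rewrite -(comp_assoc (pt g)) tanz_nat comp_assoc -!(comp_assoc _ (zt _)) tanz_nat.
rewrite E1 E2 in E.
exact/(incl_mono (k := K))/l_mono/l_mono/(emul_cancel E).
Qed.

Definition lie_differential : differential_object X :=
  DifferentialObject lie_addA lie_addC lie_add0 hat_z hat_s hat_zero hat_add
    hat_l hsplitK hsplitVK.

Lemma vlift_Ti : vlift lie_differential ;; Tm i = i ;; lt M.
Proof.
have [[v_p v_hat] _] := vlift_unique lie_differential.
have Ed : dhat lie_differential = hat by [].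
rewrite Ed in v_hat.
by rewrite Ti_kappa kappa_comp v_p v_hat (kappa0l _ (lie_zeroE _)) comp_idl.
Qed.

(** Composition with the monic [Tm i] turns [vlift] into [lt M], which gives the same condition as
    for values of PLIVFs at the unit. *)
Lemma multilinear_i l (f : diff_prod l ~> lie_differential) :
  multilinear l f <->
  (forall k, k < length l -> diff_lift k l ;; Tm (f ;; i) = f ;; i ;; lt M).
Proof.
split=> hf k hk.
- by rewrite fmap_comp comp_assoc hf // -comp_assoc vlift_Ti comp_assoc.
- apply: Ti_mono.
  by rewrite -(comp_assoc f) vlift_Ti -(comp_assoc _ (Tm f)) -fmap_comp hf // comp_assoc.
Qed.

End DiffOfTangent.

Lemma tangent_differentiable (G : group_object X) :
  tangently_representable G -> differentiably_representable G.
Proof.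
move=> [g [phi hphi]].
pose K := rep_kernel (phi 0).
pose H := grp_of G.
pose j := rep_incl (phi 1).
(* The compatibility with [tau] is applied to the universal PLIVF at level 0, which [phi 0] sends to
   the identity. *)
have hj : j = Tm (incl K) ;; ct G.
  have := hphi 0 g (rep_inv (phi 0) (idm g)); rewrite rep_invK fmap_id => E.
  have := rep_inclE (phi 1) (tau (rep_inv (phi 0) (idm g))).
  rewrite E comp_idl => Ej; exact: (etrans Ej (at_unit_tau _)).
pose K1 : kernel (tg H) (T X g) :=
  @Kernel (T X G) (tg H) (T X g) j (incl_p (rep_kernel (phi 1)))
    (incl_fac (rep_kernel (phi 1))) (incl_mono (k := rep_kernel (phi 1))).
exists (@lie_differential _ _ _ K K1 hj), (phi 0) => l.
split=> [V /multilinear_PLIVF_at_unit hV | f /multilinear_i hf].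
- by apply/multilinear_i => k hk; rewrite (rep_inclE (phi 0)) hV.
- apply/multilinear_PLIVF_at_unit => k hk.
  by rewrite -(rep_inclE (phi 0)) rep_invK hf.
Qed.

(** * From differentiable to tangent representability *)

Section TangentOfDiff.
Variables (G : group_object X) (g : differential_object X).
Variables (K : kernel (grp_of G) g).
Hypothesis lin : vlift g ;; Tm (incl K) = incl K ;; lt G.

Let H := grp_of G.

Lemma dadd0r D (x : D ~> g) : <| x, bang ;; dzero g |> ;; dadd g = x.
Proof.
rewrite -daddC comp_assoc pair_comp fp_pair_pi1 fp_pair_pi2.
have -> : bang ;; dzero g = x ;; (bang ;; dzero g).
  by rewrite comp_assoc; congr (_ ;; _); apply: fp_bang_uniq.
by rewrite -{2}(comp_idr x) -pair_comp -comp_assoc dadd0 comp_idr.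
Qed.

Lemma dadd0l D (x : D ~> g) : <| bang ;; dzero g, x |> ;; dadd g = x.
Proof.
rewrite -[RHS]dadd0r -{2}daddC comp_assoc pair_comp fp_pair_pi1 fp_pair_pi2.
by [].
Qed.

Lemma dsplit_mono D (u v : D ~> T X g) :
  u ;; pt g = v ;; pt g -> u ;; dhat g = v ;; dhat g -> u = v.
Proof.
move=> E1 E2.
by rewrite -[u]comp_idr -[v]comp_idr -(dsplitVK g) !comp_assoc !pair_comp E1 E2.
Qed.

Lemma bang_zero_comp D D' (h : D' ~> D) : h ;; (bang ;; dzero g) = bang ;; dzero g.
Proof. by rewrite comp_assoc; congr (_ ;; _); apply: fp_bang_uniq. Qed.

Lemma vlift_p : vlift g ;; pt g = bang ;; dzero g.
Proof. exact: (proj1 (proj1 (vlift_unique g))). Qed.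

Lemma vlift_hat : vlift g ;; dhat g = idm g.
Proof. exact: (proj2 (proj1 (vlift_unique g))). Qed.

(** A tangent vector is the zero vector at its base point plus the lift of its [dhat] component;
    both coordinates of the differential object confirm this. *)
Lemma tangent_vector_decomp :
  <| pt g ;; zt g, dhat g ;; vlift g |> ;; Tprod X g g ;; Tm (dadd g) = idm _.
Proof.
move: (vlift g) vlift_p vlift_hat => v v_p v_hat; apply: dsplit_mono; rewrite comp_idl.
- rewrite -comp_assoc -tanp_nat comp_assoc -[RHS]dadd0r; congr (_ ;; _).
  apply: fp_pair_uniq; rewrite -!(comp_assoc _ (pt _))
    ?(tanp_nat (T X) (fp_pi1 _ _ _)) ?(tanp_nat (T X) (fp_pi2 _ _ _)) !comp_assoc.
  + by rewrite Tprod1_comp !fp_pair_pi1 -comp_assoc tanz_p comp_idr.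
  + by rewrite Tprod2_comp !fp_pair_pi2 -comp_assoc v_p bang_zero_comp.
- rewrite -!comp_assoc (comp_assoc (Tprod _ _ _)) dhat_add comp_assoc.
  rewrite /prod_map pair_comp !comp_assoc fp_pair_pi1 fp_pair_pi2.
  by rewrite -!(comp_assoc _ _ (dhat g)) dhat_z v_hat bang_zero_comp comp_idr dadd0l.
Qed.

Lemma is_sum_vlift :
  is_sum (p1 ;; vlift g) (p2 ;; vlift g) (dadd g ;; vlift g).
Proof.
move: (vlift g) vlift_p vlift_hat => v v_p v_hat.
have E : (fp_pi1 (ct_prod X) g g ;; v) ;; pt g = (p2 ;; v) ;; pt g.
  by rewrite -!comp_assoc v_p !bang_zero_comp.
have [w S] := is_sum_ex E.
suff <- : w = dadd g ;; v by [].
have [u [Hu1 [Hu2 Hu3]]] := S.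
apply: dsplit_mono.
- rewrite -Hu3 -(comp_assoc u) tans_p -tpi1_p comp_assoc Hu1 -!comp_assoc v_p.
  by rewrite !bang_zero_comp.
- rewrite -Hu3 -(comp_assoc u) dhat_s comp_assoc pair_comp !comp_assoc Hu1 Hu2.
  rewrite -!comp_assoc v_hat !comp_idr.
  have -> : <| p1, p2 |> = idm (g ** g).
    by apply: fp_pair_uniq; rewrite ?fp_pair_pi1 ?fp_pair_pi2 comp_idl.
  by rewrite comp_idl.
Qed.

(** Linearity of the inclusion forces the given addition to be the group multiplication: after the
    monic lift, both sides are the fibrewise sum of the same two vectors over the unit. *)
Lemma incl_additive : dadd g ;; incl K = emul (tg H) (p1 ;; incl K) (p2 ;; incl K).
Proof.
apply: l_mono; rewrite (hom_l H) -comp_assoc -lin comp_assoc.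
apply: (is_sum_fun (is_sum_nat (incl K) is_sum_vlift)).
rewrite -!(comp_assoc _ (vlift g)) lin !comp_assoc.
by apply: is_sum_mul; rewrite incl_l_p.
Qed.

Lemma differential_split_incl : Tm (incl K) = kappa K (pt g) (dhat g).
Proof.
have hadd := incl_additive; move: (vlift g) lin tangent_vector_decomp => v hv hdec.
rewrite -[LHS]comp_idl -hdec -comp_assoc -fmap_comp hadd.
rewrite Temul emul_comp !fmap_comp !comp_assoc Tprod1_comp Tprod2_comp fp_pair_pi1 fp_pair_pi2.
by rewrite -!(comp_assoc _ _ (Tm (incl K))) tanz_nat hv !comp_assoc.
Qed.

Definition differential_splitting : splitting K :=
  Splitting (dsplitK g) (dsplitVK g) differential_split_incl.

End TangentOfDiff.

(** * Kernels for the iterated tangent groups *)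

Lemma split_kernel_step (G : group_object X) g (K : kernel (grp_of G) g)
    (S : splitting K) :
  { K' : kernel (grp_of (tangent_group G)) (T X g) &
    (splitting K' * (incl K' = Tm (incl K) ;; ct G))%type }.
Proof.
pose K0 := kernelT S; pose S0 := splittingT S.
(* The kernel is rebuilt field by field because its group is only convertible to
   [grp_of (tangent_group G)]. *)
exists (@Kernel (T X G) (grp_of (tangent_group G)) (T X g) (incl K0) (incl_p K0)
  (incl_fac K0) (incl_mono (k := K0))).
split; last by [].
by apply: (Splitting (split_pairK S0) (split_pairVK S0)); apply: (split_incl S0).
Qed.

(** Kernel and splitting are iterated together, since each new kernel is constructed from the
    previous splitting. *)
Fixpoint split_kernel_iter (G : group_object X) g (K : kernel (grp_of G) g)
    (S : splitting K) (n : nat) :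
  { K' : kernel (grp_of (tangent_group_iter n G)) (fob_iter (T X) n g) & splitting K' } :=
  match n with
  | O => existT _ K S
  | Datatypes.S n' =>
      let (K', S') := split_kernel_iter S n' in
      let (K2, S2) := split_kernel_step S' in
      existT _ K2 (fst S2)
  end.

Lemma split_kernel_iterS (G : group_object X) g (K : kernel (grp_of G) g)
    (S : splitting K) (n : nat) :
  incl (projT1 (split_kernel_iter S (Datatypes.S n))) =
  Tm (incl (projT1 (split_kernel_iter S n))) ;; ct (tangent_group_iter n G).
Proof.
move=> /=; case: (split_kernel_iter S n) => K' S' /=.
by case: (split_kernel_step S') => K2 [].
Qed.

Lemma differentiable_tangent (G : group_object X) :
  differentiably_representable G -> tangently_representable G.
Proof.
move=> [g [phi hphi]].
pose K := rep_kernel phi.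
have lin : vlift g ;; Tm (incl K) = incl K ;; lt G.
  (* On the one-element list the identity is multilinear, so the universal PLIVF is too; its value
     at the unit is [incl K]. *)
  have [_ /(_ (idm g)) hid] := hphi (cons g nil).
  have /hid/multilinear_PLIVF_at_unit h : multilinear (cons g nil) (idm g).
    by case=> [|[|k]] //= hk; rewrite ?fmap_id ?comp_idl ?comp_idr //;
      exfalso; inversion hk as [|m hm]; inversion hm.
  exact: (h 0 (le_n 1)).
pose S := split_kernel_iter (differential_splitting lin).
exists g, (fun n => kernel_rep (projT1 (S n))) => n A V.
(* After the monic inclusion at level [n + 1], both sides become the value at the unit of
   [tau V]. *)
apply: (incl_mono (k := projT1 (S (Datatypes.S n)))).
rewrite [LHS]kernel_funE split_kernel_iterS comp_assoc -fmap_comp.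
by rewrite [X in Tm X](kernel_funE) -at_unit_tau.
Qed.

End Proposition.

Theorem proposition4p17 (X : cartesian_tangent_category) (G : group_object X)
  (hneg : admits_negatives G) (hrep : lie_representable G) :
  tangently_representable G <-> differentiably_representable G.
Proof.
split; [exact: tangent_differentiable | exact: differentiable_tangent].
Qed.
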